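(* Let $T\subset\mathbb{R}^2$ be the open triangle with vertices $O(0,0)$, $A(1,0)$, $B(0,1)$, and let $C_{\{1,2\}}$, $C_1$, $C_2$ be the constants defined in the context. Then $C_{\{1,2\}}$ is equal to the maximum positive solution $\mu$ of the transcendental equation $$\frac{1}{2\mu}+\tan\frac{1}{2\mu}=0 .$$ Moreover $C_{\{1,2\}}=\tfrac12 C_1=\tfrac12 C_2$, and $$0.24641<C_{\{1,2\}}<0.24647 .$$
   Context: Let $e_1=OA$ and $e_2=OB$ be the two legs of $T$. Write $\|v\|$ for the $L_2(T)$ norm of $v$ and $|v|_1=\|\nabla v\|_{L_2(T)^2}$ for the $H^1(T)$ semi-norm. Edge integrals of $v\in H^1(T)$ are taken in the sense of traces. Define $$V^{i}=\Big\{v\in H^1(T): \int_{e_i}v\,ds=0\Big\}\ (i=1,2),\qquad V^{\{1,2\}}=\Big\{v\in H^1(T): \int_{e_1}v\,ds=\int_{e_2}v\,ds=0\Big\},$$ $$C_i=\sup_{v\in V^{i}\setminus\{0\}}\frac{\|v\|}{|v|_1}\ (i=1,2),\qquad C_{\{1,2\}}=\sup_{v\in V^{\{1,2\}}\setminus\{0\}}\frac{\|v\|}{|v|_1}.$$ *)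

(* Defs.v *)
From HB Require Import structures.
From mathcomp Require Export all_boot all_order all_algebra.
From mathcomp Require Export all_classical all_reals all_analysis.
Set Implicit Arguments.
Unset Strict Implicit.
Unset Printing Implicit Defensive.
Export Order.TTheory GRing.Theory Num.Theory numFieldNormedType.Exports.
Local Open Scope classical_set_scope.
Local Open Scope ring_scope.

(* ||f||_{L_2(D)} as an extended real; [f \_ D] is f extended by 0 outside D. *)
Definition L2norm (d : measure_display) (X : measurableType d) (R : realType)
    (mu : {measure set X -> \bar R}) (D : set X) (f : X -> R) : \bar R :=
  'N[mu]_2%:E [EFin \o (f \_ D)]%E.

Definition in_L2 (d : measure_display) (X : measurableType d) (R : realType)
    (mu : {measure set X -> \bar R}) (D : set X) (f : X -> R) : Prop :=
  measurable_fun D f /\ (L2norm mu D f < +oo)%E.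

Section Plane.
Variable R : realType.
Implicit Types (f v w phi : R * R -> R) (g : R -> R) (e : R -> R * R).

Definition leb1 : {measure set (measurableTypeR R) -> \bar R} :=
  @lebesgue_measure R.

Definition leb2 : {measure set (measurableTypeR R * measurableTypeR R)%type
                   -> \bar R} :=
  (@lebesgue_measure R \x @lebesgue_measure R)%E.

Definition triangle : set (R * R) :=
  [set p | [/\ 0 < p.1, 0 < p.2 & p.1 + p.2 < 1]].

Definition dx f : R * R -> R := fun p => 'D_((1, 0) : R * R) f p.
Definition dy f : R * R -> R := fun p => 'D_((0, 1) : R * R) f p.

Fixpoint is_Ck (k : nat) f : Prop :=
  continuous f /\
  if k is k'.+1 then
    [/\ forall p, derivable f p (1, 0), forall p, derivable f p (0, 1),
        is_Ck k' (dx f) & is_Ck k' (dy f)]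
  else True.

Definition smooth f : Prop := forall k, is_Ck k f.

Definition test_function phi : Prop :=
  [/\ smooth phi,
      compact (closure [set p | phi p != 0]) &
      closure [set p | phi p != 0] `<=` triangle].

(* [D] is one of [dx], [dy]. *)
Definition weak_derivative (D : (R * R -> R) -> R * R -> R) v w : Prop :=
  forall phi, test_function phi ->
    \int[leb2]_(p in triangle) (v p * D phi p) =
    - \int[leb2]_(p in triangle) (w p * phi p).

(* A representative of an element of H^1(T), bundled with a representative of
   its weak gradient, which it determines up to a null set. *)
Record H1 := MkH1 {
  H1fun :> R * R -> R;
  H1dx : R * R -> R;
  H1dy : R * R -> R;
  H1fun_L2 : in_L2 leb2 triangle H1fun;
  H1dx_L2 : in_L2 leb2 triangle H1dx;
  H1dy_L2 : in_L2 leb2 triangle H1dy;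
  H1dx_weak : weak_derivative dx H1fun H1dx;
  H1dy_weak : weak_derivative dy H1fun H1dy }.

Definition H1_L2norm (v : H1) : \bar R := L2norm leb2 triangle v.

Definition H1_seminorm (v : H1) : \bar R :=
  L2norm leb2 triangle (fun p => Num.sqrt (H1dx v p ^+ 2 + H1dy v p ^+ 2)).

(* phi_n -> v in H^1(T), the phi_n being smooth on the plane. *)
Definition H1_converges (phi : nat -> R * R -> R) (v : H1) : Prop :=
  [/\ (fun n => L2norm leb2 triangle (fun p => phi n p - v p)) @ \oo --> 0%E,
      (fun n => L2norm leb2 triangle (fun p => dx (phi n) p - H1dx v p))
        @ \oo --> 0%E &
      (fun n => L2norm leb2 triangle (fun p => dy (phi n) p - H1dy v p))
        @ \oo --> 0%E].

(* Unit-speed parametrizations, over [0, 1], of the legs OA and OB. *)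
Definition legOA : R -> R * R := fun t => (t, 0).
Definition legOB : R -> R * R := fun t => (0, t).

(* g is the trace of v on the leg parametrized by e: the trace operator
   H^1(T) -> L_2(e) is the continuous extension of the restriction map
   phi |-> phi|_e defined on the restrictions to T of smooth functions. *)
Definition is_trace e (v : H1) g : Prop :=
  in_L2 leb1 `[0, 1] g /\
  exists phi : nat -> R * R -> R,
    [/\ forall n, smooth (phi n),
        H1_converges phi v &
        (fun n => L2norm leb1 `[0, 1] (fun t => phi n (e t) - g t))
          @ \oo --> 0%E].

Definition V e : set H1 :=
  [set v | exists2 g, is_trace e v g & \int[leb1]_(t in `[0, 1]) g t = 0].

Definition V1 : set H1 := V legOA.
Definition V2 : set H1 := V legOB.
Definition V12 : set H1 := V1 `&` V2.

Definition H1_zero : set H1 :=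
  [set v : H1 | {ae leb2, forall p, triangle p -> v p = 0}].

(* In \bar R, x / 0 is +oo for 0 < x: a nonzero v with |v|_1 = 0 would make
   the supremum infinite. *)
Definition sup_ratio (W : set H1) : \bar R :=
  ereal_sup [set (H1_L2norm v / H1_seminorm v)%E | v in W `\` H1_zero].

Definition C1 : \bar R := sup_ratio V1.
Definition C2 : \bar R := sup_ratio V2.
Definition C12 : \bar R := sup_ratio V12.

(* The library's tan is sin / cos with x / 0 = 0; a pole of tan is still not a
   solution, as then the left-hand side is 1 / (2 mu) > 0. *)
Definition positive_solution (mu : R) : Prop :=
  0 < mu /\ 1 / (2 * mu) + tan (1 / (2 * mu)) = 0.

End Plane.

(* Main.v *)
(* Put [p = 1 - y] and reflect [phi] evenly across the hypotenuse: this gives a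
   symmetric function [U x p] on the unit square, equal to [phi (x, 1 - p)] for
   [x < p].  Let [W] be its [x]-derivative, [A x] the integral of [U x p] in [p],
   and [c] that of [A].  Then [int U^2 = 2 |phi|^2], [int W^2 = |grad phi|^2],
   and [A 1], [A 0] are the means of [phi] over the legs OA, OB.  Wirtinger's
   inequality for the slices of [U x p - A x], with the constant [9 < pi^2], gives
     |grad phi|^2 >= int A'^2 + 9 (2 |phi|^2 - 2 int A^2 + c^2),
   and the last factor is nonnegative, so everything follows from
     int A'^2 >= l (int A^2 - c^2 / 2)
   with [l = k^2] when [A] vanishes at one end point, [l = 4 k^2] when it
   vanishes at both, [k] being the least positive root of [k cos k + sin k] (and
   [l <= 18]).  By duality the latter is a Poincare inequality with a Robin
   boundary term for a primitive [F] of [A - c / 2], proved by integrating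
   [(F' - psi F)^2] with [psi = k cot (k x)].
   The constants are attained at [cos (k x) + cos (k (1 - y))], at its mirror
   image in the diagonal, and at [cos (k (2 x - 1)) + cos (k (1 - 2 y))].
   The inequality passes from smooth functions to H^1(T) because the mean over a
   leg is bounded by the H^1 norm. *)
Require Import Defs.
From mathcomp Require Import measurable_realfun ring lra.
Set Implicit Arguments.
Unset Strict Implicit.
Unset Printing Implicit Defensive.
Local Open Scope classical_set_scope.
Local Open Scope ring_scope.

(** * Integration of bounded measurable functions on the unit interval and square *)

(** The factor that 9 multiplies is the integral of [(U x p - A x - A p + c)^2]. It vanishes for
    additive kernels [U x p = f x + f p], that is for [phi (x, y) = f x + f (1 - y)]: on these
    functions the problem is one-dimensional, and all three extremals are of this form. Any constant
    between 2 k^2 (about 8.23) and pi^2 could stand for 9; the choice 9 = 3^2 asks only that cos be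
    positive on [-3/2, 3/2], which a Taylor polynomial shows. The form int A^2 - c^2 / 2 is nonlocal
    because of c. A primitive [F] of [A - c / 2] grows by c / 2 over the interval, so that c becomes
    a boundary value of [F]: this is where the Robin term comes from, and its coefficient 1 matches
    k cot k = - 1. The obstacle to calculus is that [W] jumps across the diagonal. Continuous
    integrands do not suffice, whence bounded measurable ones ([bmeas], [bmeas2]), and the
    derivative of [A] is handled only through integration by parts ([wder]). *)

Section Continuity.
Context {R : realType}.

Lemma continuous_pair (T : topologicalType) (f g : T -> R) :
  continuous f -> continuous g -> continuous (fun t => (f t, g t)).
Proof.
move=> cf cg t.
exact: (@cvg_pair _ _ _ (nbhs t) (nbhs (f t)) (nbhs (g t)) _ _ _ f g (cf t) (cg t)).
Qed.

Lemma continuous_fst : continuous (fun z : R * R => z.1).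
Proof. by move=> [x y]; exact: cvg_fst. Qed.

Lemma continuous_snd : continuous (fun z : R * R => z.2).
Proof. by move=> [x y]; exact: cvg_snd. Qed.

Lemma continuous_slice1 (g : R -> R -> R) y :
  continuous (fun z : R * R => g z.1 z.2) -> continuous (g ^~ y).
Proof.
move=> cg x; apply: (@continuous_comp _ _ _ (fun x : R => (x, y)) (fun z => g z.1 z.2)).
  by apply: continuous_pair => t; [exact: cvg_id|exact: cvg_cst].
exact: cg.
Qed.

Lemma continuous_slice2 (g : R -> R -> R) x :
  continuous (fun z : R * R => g z.1 z.2) -> continuous (g x).
Proof.
move=> cg y; apply: (@continuous_comp _ _ _ (fun y : R => (x, y)) (fun z => g z.1 z.2)).
  by apply: continuous_pair => t; [exact: cvg_cst|exact: cvg_id].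
exact: cg.
Qed.

Lemma continuous_line1 (phi : R * R -> R) (y : R) : continuous phi ->
  continuous (fun x => phi (x, y)).
Proof.
move=> c; apply: (continuous_slice1 (g := fun x y => phi (x, y))).
by rewrite (_ : (fun z => _) = phi)//; apply/funext => -[].
Qed.

Lemma continuous_line2 (phi : R * R -> R) (x : R) : continuous phi ->
  continuous (fun y => phi (x, y)).
Proof.
move=> c; apply: (continuous_slice2 (g := fun x y => phi (x, y))).
by rewrite (_ : (fun z => _) = phi)//; apply/funext => -[].
Qed.

Lemma continuous_sqr (phi : R * R -> R) : continuous phi ->
  continuous (fun z => phi z ^+ 2).
Proof. by move=> c z; exact: (cvgM (c z) (c z)). Qed.

End Continuity.

Section BoundedMeasurable.
Context {R : realType}.
Implicit Types (f g : R -> R) (F G : R -> R -> R).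

(** The plane carries the product of two Borel structures, so open sets must be shown measurable: an
    open set is the union of the countably many boxes with rational end points that it contains. *)
Lemma continuous2_measurable (f : R * R -> R) : continuous f ->
  measurable_fun (setT : set (measurableTypeR R * measurableTypeR R)) f.
Proof.
move=> cf; apply: (measurability _ (RGenOInfty.measurableE R)).
move=> /= _ [_ [a ->]] <-; rewrite setTI.
set P := _ @^-1` _.
have oP : open P.
  by apply: open_comp => [x _|]; [exact: cf|exact: interval_open].
pose box (i : rat * rat * (rat * rat)) : set (R * R) :=
  `]ratr i.1.1, ratr i.1.2[ `*` `]ratr i.2.1, ratr i.2.2[.
(* Boxes that are not contained in [P] are replaced by the empty set, so that the union runs over a
   whole countable type. *)
pose B i := if `[< box i `<=` P >] then box i else set0.
have -> : P = \bigcup_i B i.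
  apply/seteqP; split => [[x y] Pp|p [i _]]; last first.
    by rewrite /B; case: asboolP => // h /h.
  have /nbhs_ballP[e /= e0 eP] : nbhs (x, y) P by exact: open_nbhs_nbhs.
  have le1 z : z - e < z by rewrite ltrBlDr ltrDl.
  have le2 z : z < z + e by rewrite ltrDl.
  have [q1] := rat_in_itvoo (le1 x); have [q2] := rat_in_itvoo (le2 x).
  have [q3] := rat_in_itvoo (le1 y); have [q4] := rat_in_itvoo (le2 y).
  rewrite !in_itv/= => /andP[? ?] /andP[? ?] /andP[? ?] /andP[? ?].
  exists (q1, q2, (q3, q4)) => //; rewrite /B; case: asboolP; last first.
    case=> -[u v] [] /=; rewrite !in_itv/= => /andP[? ?] /andP[? ?].
    by apply: eP; split; rewrite /= /ball/= ltr_norml; apply/andP; split; lra.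
  by move=> _; split; rewrite /= in_itv/=; apply/andP; split.
apply: countable_bigcupT_measurable; first exact: countableP.
move=> i; rewrite /B; case: asboolP => _; last exact: measurable0.
by apply: measurableX; exact: measurable_itv.
Qed.

Definition int01 f : R := \int[leb1 R]_(t in `[0, 1]) f t.

(** A class closed under sums, products and case distinctions, all of whose members are integrable
    on [0, 1]; integrability alone would not pass to products. *)
Definition bmeas f : Prop := measurable_fun (`[0, 1] : set (measurableTypeR R)) f /\
  exists M, forall x, x \in `[0, 1] -> `|f x| <= M.

Definition square : set (measurableTypeR R * measurableTypeR R) :=
  `[0, 1] `*` `[0, 1].

Definition bmeas2 F : Prop := measurable_fun square (fun z => F z.1 z.2) /\
  exists M, forall x y, x \in `[0, 1] -> y \in `[0, 1] -> `|F x y| <= M.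

Lemma measurable_square : measurable square.
Proof. by apply: measurableX; exact: measurable_itv. Qed.

Lemma leb1_itv01 : leb1 R `[0, 1]%classic = 1%E.
Proof.
have := @lebesgue_measure_itv R `[0, 1].
by rewrite /= lte_fin ltr01 oppr0 adde0.
Qed.

Lemma bmeas_integrable f : bmeas f ->
  (leb1 R).-integrable (`[0, 1] : set (measurableTypeR R)) (EFin \o f).
Proof.
move=> [mf [M fM]]; apply: measurable_bounded_integrable => //.
- by rewrite [X in (X < _)%E]leb1_itv01 ltry.
- exists M; split; first exact: num_real.
  by move=> x /ltW Mx y /= y01; rewrite (le_trans _ Mx)// fM.
Qed.

Lemma bmeas_cst c : bmeas (fun=> c).
Proof. by split=> //; exists `|c|. Qed.

Lemma bmeasD f g : bmeas f -> bmeas g -> bmeas (fun x => f x + g x).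
Proof.
move=> [mf [M fM]] [mg [N gN]]; split; first exact: measurable_funD.
exists (M + N) => x x01; rewrite (le_trans (ler_normD _ _))//.
by rewrite lerD ?fM ?gN.
Qed.

Lemma bmeasM f g : bmeas f -> bmeas g -> bmeas (fun x => f x * g x).
Proof.
move=> [mf [M fM]] [mg [N gN]]; split; first exact: measurable_funM.
by exists (M * N) => x x01; rewrite normrM ler_pM ?fM ?gN.
Qed.

Lemma bmeasN f : bmeas f -> bmeas (fun x => - f x).
Proof.
move=> [mf [M fM]]; split; first exact: measurableT_comp.
by exists M => x x01; rewrite normrN fM.
Qed.

Lemma bmeasB f g : bmeas f -> bmeas g -> bmeas (fun x => f x - g x).
Proof. by move=> mf mg; apply: bmeasD => //; exact: bmeasN. Qed.

Lemma bmeasX f n : bmeas f -> bmeas (fun x => f x ^+ n).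
Proof.
move=> mf; elim: n => [|n ih]; first exact: bmeas_cst.
by under eq_fun do rewrite exprS; exact: bmeasM.
Qed.

Lemma bmeas_if (b : R -> bool) f g :
  measurable_fun (`[0, 1] : set (measurableTypeR R)) b -> bmeas f -> bmeas g ->
  bmeas (fun x => if b x then f x else g x).
Proof.
move=> mb [mf [M fM]] [mg [N gN]]; split.
  apply: measurable_fun_if => //.
  - by apply: measurable_funS mf => //; exact: subIsetl.
  - by apply: measurable_funS mg => //; exact: subIsetl.
exists (Num.max M N) => x x01.
by rewrite le_max; case: ifPn => _; rewrite ?fM ?gN ?orbT.
Qed.

Lemma bmeas_if_lt (p : R) f g : bmeas f -> bmeas g ->
  bmeas (fun x => if x < p then f x else g x).
Proof.
by apply: bmeas_if; apply: measurable_fun_ltr => //; exact: measurable_cst.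
Qed.

Lemma bmeas_if_gt (p : R) f g : bmeas f -> bmeas g ->
  bmeas (fun x => if p < x then f x else g x).
Proof.
by apply: bmeas_if; apply: measurable_fun_ltr => //; exact: measurable_cst.
Qed.

Lemma within_continuous_bmeas f : {within `[0, 1], continuous f} -> bmeas f.
Proof.
move=> cf; split; first exact: subspace_continuous_measurable_fun.
have cNf : {within `[0, 1], continuous (fun x => - f x)}.
  by move=> x; apply: continuousN; exact: cf.
have [c c01 cM] := EVT_max ler01 cf; have [d d01 dM] := EVT_max ler01 cNf.
exists (Num.max (f c) (- f d)) => x x01.
by rewrite ler_norml lerNl !le_max cM// dM ?orbT.
Qed.

Lemma continuous_bmeas f : continuous f -> bmeas f.
Proof. by move=> cf; apply/within_continuous_bmeas/continuous_subspaceT. Qed.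

End BoundedMeasurable.

Ltac bmeas_tac := repeat first [ assumption | exact: bmeas_cst | exact: bmeasX
  | apply: bmeasX | apply: bmeasN | apply: bmeasD | apply: bmeasM ].

(** * Integrals over the unit interval and Fubini's theorem on the unit square *)

Section UnitIntegral.
Context {R : realType}.
Implicit Types (c : R) (f g : R -> R) (F G : R -> R -> R).

Lemma eq_int01 f g : (forall x, x \in `[0, 1] -> f x = g x) ->
  int01 f = int01 g.
Proof. by move=> fg; apply: eq_Rintegral => x /[!inE] x01; exact: fg. Qed.

Lemma int01D f g : bmeas f -> bmeas g ->
  int01 (fun x => f x + g x) = int01 f + int01 g.
Proof. by move=> mf mg; apply: RintegralD => //; exact: bmeas_integrable. Qed.

Lemma int01B f g : bmeas f -> bmeas g ->
  int01 (fun x => f x - g x) = int01 f - int01 g.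
Proof. by move=> mf mg; apply: RintegralB => //; exact: bmeas_integrable. Qed.

Lemma int01Zl c f : bmeas f -> int01 (fun x => c * f x) = c * int01 f.
Proof. by move=> mf; apply: RintegralZl => //; exact: bmeas_integrable. Qed.

Lemma int01Zr c f : bmeas f -> int01 (fun x => f x * c) = int01 f * c.
Proof. by move=> mf; apply: RintegralZr => //; exact: bmeas_integrable. Qed.

Lemma int01_cst c : int01 (fun=> c) = c.
Proof.
rewrite /int01 Rintegral_cst//.
by rewrite [X in fine X]leb1_itv01 mulr1.
Qed.

Lemma int01_ge0 f : (forall x, x \in `[0, 1] -> 0 <= f x) -> 0 <= int01 f.
Proof. by move=> f0; apply: Rintegral_ge0 => x /= x01; exact: f0. Qed.

Lemma ler_int01 f g : bmeas f -> bmeas g ->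
  (forall x, x \in `[0, 1] -> f x <= g x) -> int01 f <= int01 g.
Proof. by move=> mf mg fg; apply: le_Rintegral => //; exact: bmeas_integrable. Qed.

(** The interval has length one, so the difference of the two sides is the variance, the integral of
    [(f x - m) ^+ 2]. *)
Lemma sqr_int01_le f : bmeas f -> int01 f ^+ 2 <= int01 (fun x => f x ^+ 2).
Proof.
move=> mf; set m := int01 f.
have : 0 <= int01 (fun x => f x ^+ 2 - 2 * m * f x + m ^+ 2).
  apply: int01_ge0 => x _.
  by rewrite (_ : _ + _ = (f x - m) ^+ 2) ?sqr_ge0//; ring.
rewrite int01D ?int01B ?int01Zl ?int01_cst -/m; [lra|bmeas_tac..].
Qed.

Lemma bmeas2D F G : bmeas2 F -> bmeas2 G -> bmeas2 (fun x y => F x y + G x y).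
Proof.
move=> [mf [M fM]] [mg [N gN]]; split; first exact: measurable_funD.
exists (M + N) => x y x01 y01; rewrite (le_trans (ler_normD _ _))//.
by rewrite lerD ?fM ?gN.
Qed.

Lemma bmeas2M F G : bmeas2 F -> bmeas2 G -> bmeas2 (fun x y => F x y * G x y).
Proof.
move=> [mf [M fM]] [mg [N gN]]; split; first exact: measurable_funM.
by exists (M * N) => x y x01 y01; rewrite normrM ler_pM ?fM ?gN.
Qed.

Lemma bmeas2N F : bmeas2 F -> bmeas2 (fun x y => - F x y).
Proof.
move=> [mf [M fM]]; split; first exact: measurableT_comp.
by exists M => x y x01 y01; rewrite normrN fM.
Qed.

Lemma bmeas2B F G : bmeas2 F -> bmeas2 G -> bmeas2 (fun x y => F x y - G x y).
Proof. by move=> mf mg; apply: bmeas2D => //; exact: bmeas2N. Qed.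

Lemma bmeas2_fst f : bmeas f -> bmeas2 (fun x _ => f x).
Proof.
move=> [mf [M fM]]; split; last by exists M => x y x01 _; exact: fM.
apply: (@measurable_comp _ _ _ _ _ _ (`[0, 1]%classic : set (measurableTypeR R))
  f square fst) => //.
- by move=> _ [[x y] [/= x01 _] <-].
- by apply: measurable_funTS; exact: measurable_fst.
Qed.

Lemma bmeas2_swap F : bmeas2 F -> bmeas2 (fun x y => F y x).
Proof.
move=> [mf [M fM]]; split; last by exists M => x y x01 y01; exact: fM.
apply: (@measurable_comp _ _ _ _ _ _ square (fun z => F z.1 z.2) square
  (fun z => (z.2, z.1))) => //.
- exact: measurable_square.
- by move=> _ [[x y] [/= x01 y01] <-].
- by apply: measurable_funTS; exact: (@measurable_swap _ _ (measurableTypeR R) (measurableTypeR R)).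
Qed.

Lemma bmeas2_snd f : bmeas f -> bmeas2 (fun _ y => f y).
Proof. by move=> mf; apply: (@bmeas2_swap (fun x _ => f x)); exact: bmeas2_fst. Qed.

Lemma bmeas2_if_lt F G : bmeas2 F -> bmeas2 G ->
  bmeas2 (fun x y => if x < y then F x y else G x y).
Proof.
move=> [mF [M FM]] [mG [N GN]]; split.
  apply: measurable_fun_if => //.
  - exact: measurable_square.
  - apply: measurable_fun_ltr; apply: measurable_funTS.
      exact: measurable_fst.
    exact: measurable_snd.
  - apply: measurable_funS mF; [exact: measurable_square|exact: subIsetl].
  - apply: measurable_funS mG; [exact: measurable_square|exact: subIsetl].
exists (Num.max M N) => x y x01 y01.
by rewrite le_max; case: ifPn => _; rewrite ?FM ?GN ?orbT.
Qed.

Lemma bmeas2X F n : bmeas2 F -> bmeas2 (fun x y => F x y ^+ n).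
Proof.
move=> mf; elim: n => [|n ih]; first exact: (@bmeas2_fst (fun=> 1) (bmeas_cst 1)).
rewrite (_ : (fun x y => _) = (fun x y => F x y * F x y ^+ n)).
  exact: bmeas2M.
by apply/funext => x; apply/funext => y; rewrite exprS.
Qed.

Lemma continuous_bmeas2 F : continuous (fun z => F z.1 z.2) -> bmeas2 F.
Proof.
move=> cF; split; first by apply: measurable_funTS; exact: continuous2_measurable.
have : compact (`[0, 1] `*` `[0, 1] : set (R * R)).
  by apply: compact_setX; exact: segment_compact.
move=> cQ; have Q0 : (`[0, 1] `*` `[0, 1] : set (R * R)) !=set0.
  by exists (0, 0); split; rewrite /= in_itv/= lexx ler01.
have cNF : continuous (fun z : R * R => - F z.1 z.2).
  by move=> z; apply: continuousN; exact: cF.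
have [c _ cM] := compact_EVT_max Q0 cQ (continuous_subspaceT cF).
have [d _ dM] := compact_EVT_max Q0 cQ (continuous_subspaceT cNF).
exists (Num.max (F c.1 c.2) (- F d.1 d.2)) => x y x01 y01.
have xy : (x, y) \in (`[0, 1] `*` `[0, 1] : set (R * R)) by rewrite inE.
by rewrite ler_norml lerNl !le_max (cM (x, y))// (dM (x, y))// orbT.
Qed.

Lemma bmeas2_slice F x : x \in `[0, 1] -> bmeas2 F -> bmeas (F x).
Proof.
move=> x01 [mF [M FM]]; split; last by exists M => y; exact: FM.
apply: (@measurable_comp _ _ _ _ (measurableTypeR R * measurableTypeR R)%type _
  square (fun z => F z.1 z.2) _ (fun y => (x, y))) => //.
- exact: measurable_square.
- by move=> _ [y y01 <-].
- by apply: measurable_funTS; exact: measurable_pair1.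
Qed.

(** Extension by zero reduces integration over the square to the product-measure theorems on the
    whole plane. *)
Let F0 F := EFin \o ((fun z => F z.1 z.2) \_ square).

Let F0_integrable F : bmeas2 F ->
  (@lebesgue_measure R \x @lebesgue_measure R)%E.-integrable setT (F0 F).
Proof.
move=> mF; rewrite /F0 -restrict_EFin.
apply/integrable_restrict => //; first exact: measurable_square.
rewrite setTI; apply: measurable_bounded_integrable.
- exact: measurable_square.
- rewrite [X in (X < _)%E](_ : _ = 1%E) ?ltry//.
  apply: etrans (product_measure1E _ _ _ _) _ => //.
  by rewrite [X in (X * X)%E]leb1_itv01 mule1.
- exact: mF.1.
- case: mF => _ [M FM]; exists M; split; first exact: num_real.
  move=> r /ltW Mr [x y] /= [x01 y01].
  by rewrite (le_trans _ Mr)// FM.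
Qed.

Let F0_slice F : bmeas2 F -> fubini_F (@lebesgue_measure R) (F0 F) =
  EFin \o ((fun x => int01 (F x)) \_ `[0, 1]).
Proof.
move=> mF; apply/funext => x; rewrite /fubini_F /F0 /= patchE.
case: ifPn => [|/negP]; rewrite inE /= => x01; last first.
  rewrite integral0_eq// => y _; rewrite patchE; case: ifPn => //.
  by rewrite inE => -[].
transitivity (\int[leb1 R]_(y in `[0%R, 1%R]) (F x y)%:E)%E.
  rewrite [RHS]integral_mkcond; apply: eq_integral => y _ /=.
  rewrite !patchE; case: ifPn => [|/negP]; rewrite inE /square/=.
    by move=> [_ y01]; rewrite mem_set.
  by move=> xy; rewrite memNset// => y01; exact: xy.
rewrite /int01 /Rintegral fineK//; apply: integrable_fin_num => //.
by apply: bmeas_integrable; exact: bmeas2_slice.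
Qed.

Lemma bmeas_int01 F : bmeas2 F -> bmeas (fun x => int01 (F x)).
Proof.
move=> mF; split.
  apply/(measurable_restrictT _ (measurable_itv _)).
  have := measurable_fubini_F (F0_integrable mF).
  by rewrite F0_slice// => /measurable_EFinP.
case: (mF) => _ [M FM]; exists M => x x01.
have mFx := bmeas2_slice x01 mF.
rewrite (le_trans (le_normr_Rintegral _ (bmeas_integrable mFx)))//.
have mN : bmeas (fun y => `|F x y|).
  split; first by apply: measurableT_comp => //; exact: mFx.1.
  by exists M => y y01; rewrite normr_id; exact: FM.
rewrite -[leRHS]int01_cst; apply: ler_int01 => //; first exact: bmeas_cst.
by move=> y; exact: FM.
Qed.

Lemma int01_square F : bmeas2 F ->
  \int[leb2 R]_(z in square) F z.1 z.2 = int01 (fun x => int01 (F x)).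
Proof.
move=> mF; have := integral12_prod_meas1 (F0_integrable mF).
rewrite F0_slice// => h.
rewrite Rintegral_mkcond [LHS]/Rintegral [X in fine X](esym h).
by rewrite /int01 [RHS]Rintegral_mkcond.
Qed.

Lemma int01_swap F : bmeas2 F ->
  int01 (fun x => int01 (F x)) = int01 (fun y => int01 (fun x => F x y)).
Proof.
move=> mF; have := Fubini (F0_integrable mF).
have := F0_slice mF; rewrite /fubini_F => -> .
have := F0_slice (bmeas2_swap mF); rewrite /fubini_F.
rewrite (_ : (fun x => integral _ _ (fun y => F0 (fun _ _ => _) _)) =
  (fun y => (\int[lebesgue_measure]_x F0 F (x, y)))%E); last first.
  apply/funext => x; apply: eq_integral => y _; rewrite /F0/= !patchE.
  congr (_ : R)%:E; congr (if _ then _ else _).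
  by apply/idP/idP; rewrite !inE => -[? ?]; split.
move=> -> h; rewrite /int01 [LHS]Rintegral_mkcond [RHS]Rintegral_mkcond.
by rewrite /Rintegral /leb1 -[X in fine X = _]/(integral _ _ _) h.
Qed.

End UnitIntegral.

(** * Calculus on the unit interval *)

Section Calculus.
Context {R : realType}.
Implicit Types (f g F G A a : R -> R).

(** The derivative is two-sided even at 0 and 1, so the usual product and chain rules apply there,
    while [f] is continuous only relative to [0, 1]. *)
Definition C1on F f : Prop := {within `[0, 1], continuous f} /\
  forall x : R, x \in `[0, 1] -> is_derive x 1 F (f x).

Lemma is_derive_continuous F (x d : R) : is_derive x 1 F d -> {for x, continuous F}.
Proof.
by move=> [dF _]; apply/differentiable_continuous/derivable1_diffP.
Qed.

Lemma C1on_continuous F f : C1on F f -> {within `[0, 1], continuous F}.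
Proof.
move=> [_ dF]; apply/continuous_in_subspaceT => x /[!inE] x01.
exact: is_derive_continuous (dF x x01).
Qed.

Lemma bmeasC1 F f : C1on F f -> bmeas F.
Proof. by move/C1on_continuous/within_continuous_bmeas. Qed.

Lemma bmeasC1' F f : C1on F f -> bmeas f.
Proof. by move=> [+ _]; exact: within_continuous_bmeas. Qed.

Lemma FTC F f b c : 0 <= b -> b <= c -> c <= 1 -> C1on F f ->
  \int[leb1 R]_(t in `[b, c]) f t = F c - F b.
Proof.
move=> b0; rewrite le_eqVlt => /predU1P[<- _ _|bc c1 [cf dF]].
  by rewrite set_itv1 Rintegral_set1 subrr.
have sub x : x \in `[b, c] -> x \in `[0, 1].
  by rewrite !in_itv/= => /andP[xb xc]; apply/andP; split; lra.
rewrite /Rintegral (continuous_FTC2 (F := F) bc)//.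
- by apply: continuous_subspaceW cf => x /=; exact: sub.
- split=> [x xbc||].
  + by have [] := dF x (sub _ (subset_itv_oo_cc xbc)).
  + apply: cvg_at_right_filter; apply: is_derive_continuous (dF b _).
    by rewrite in_itv/= b0 (le_trans (ltW bc)).
  + apply: cvg_at_left_filter; apply: is_derive_continuous (dF c _).
    by rewrite in_itv/= c1 (le_trans b0 (ltW bc)).
- move=> x xbc; rewrite derive1E.
  by have [_ ->] := dF x (sub _ (subset_itv_oo_cc xbc)).
Qed.

Lemma int01_FTC F f : C1on F f -> int01 f = F 1 - F 0.
Proof. by move=> C1; rewrite /int01 (FTC _ _ _ C1). Qed.

Lemma C1on_cst c : C1on (fun=> c) (fun=> 0).
Proof. by split=> [|x _]; [exact/continuous_subspaceT/cst_continuous|exact: is_derive_cst]. Qed.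

Lemma C1on_id : C1on (fun x => x) (fun=> 1).
Proof. by split=> [|x _]; [exact/continuous_subspaceT/cst_continuous|exact: is_derive_id]. Qed.

Lemma C1onD F f G g : C1on F f -> C1on G g ->
  C1on (fun x => F x + G x) (fun x => f x + g x).
Proof.
move=> [cf dF] [cg dG]; split=> [x|x x01]; first exact: cvgD (cf x) (cg x).
by apply: is_deriveD; [exact: dF|exact: dG].
Qed.

Lemma C1onM F f G g : C1on F f -> C1on G g ->
  C1on (fun x => F x * G x) (fun x => f x * G x + F x * g x).
Proof.
move=> CF CG; have [cf dF] := CF; have [cg dG] := CG; split=> [x|x x01].
  apply: cvgD; apply: cvgM; [exact: cf|exact: (C1on_continuous CG)|
    exact: (C1on_continuous CF)|exact: cg].
have := is_deriveM (dF x x01) (dG x x01); rewrite addrC.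
by rewrite /GRing.scale/= (mulrC (G x)).
Qed.

Lemma eq_C1on F f g : (forall x, x \in `[0, 1] -> f x = g x) -> C1on F f -> C1on F g.
Proof.
move=> fg [cf dF]; split; last by move=> x x01; rewrite -fg//; exact: dF.
apply: subspace_eq_continuous cf => x /[!inE] x01; exact: fg.
Qed.

Lemma C1onZ c F f : C1on F f -> C1on (fun x => c * F x) (fun x => c * f x).
Proof.
move=> CF; have := C1onM (C1on_cst c) CF; apply: eq_C1on => x _.
by rewrite mul0r add0r.
Qed.

(** Retraction of the line onto [0, 1]. Composing with it extends a function by its end values,
    which gives a primitive with two-sided derivatives at 0 and 1. *)
Let clamp (x : R) : R := Num.max 0 (Num.min x 1).

Let clamp01 x : clamp x \in `[0, 1].
Proof. by rewrite in_itv/= le_max lexx ge_max ler01 ge_min lexx orbT. Qed.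

Let clampE x : x \in `[0, 1] -> clamp x = x.
Proof. by rewrite in_itv/= => /andP[? ?]; rewrite /clamp min_l// max_r. Qed.

Lemma C1on_primitive f : {within `[0, 1], continuous f} -> exists F, C1on F f.
Proof.
move=> cf; pose h x := f (clamp x).
have ch : continuous h.
  move=> x; apply: (@cvg_comp _ _ _ clamp f _ (within `[0, 1] (nbhs (clamp x)))).
    have cc : {for x, continuous clamp}.
      apply: continuous_max; first exact: cst_continuous.
      by apply: continuous_min; [exact: cvg_id|exact: cst_continuous].
    move=> P /= /cc; apply: (@filterS _ (nbhs x)) => y /=; apply; exact: clamp01.
  by move/subspace_continuousP : cf; apply; exact: clamp01.
(* Starting at -1 puts 0 strictly inside the domain of integration. *)
exists (fun x => \int[leb1 R]_(t in `[-1, x]) h t); split=> // x x01.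
have x0 : 0 <= x by move: x01; rewrite in_itv/= => /andP[].
have [||||dF dE] := @continuous_FTC1 R h (BLeft (-1)) x (x + 1).
- by rewrite ltrDl.
- apply: continuous_compact_integrable; first exact: segment_compact.
  exact: continuous_subspaceT.
- by rewrite /= lte_fin; lra.
- exact: ch.
by split=> //; rewrite -derive1E dE /h clampE.
Qed.

End Calculus.

(** * The transcendental equation *)

Section TrigBounds.
Context {R : realType}.
Implicit Types (x : R).

Lemma nneg_of_derive (f df : R -> R) : 0 <= f 0 ->
  (forall x, is_derive x 1 f (df x)) -> (forall x, 0 <= x -> 0 <= df x) ->
  forall x, 0 <= x -> 0 <= f x.
Proof.
move=> f0 dF df0 x; rewrite le_eqVlt => /predU1P[<-//|x0].
have [c|c] := MVT x0 (fun y _ => dF y) _.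
  apply: continuous_subspaceT => y; exact: is_derive_continuous (dF y).
rewrite in_itv/= => /andP[/ltW c0 _] E.
have : 0 <= df c * (x - 0) by rewrite mulr_ge0 ?df0// subr0 ltW.
by rewrite -E; lra.
Qed.

Let is_derive_monomial (c : R) n x :
  is_derive x 1 (fun y => c * y ^+ n.+1) (c * (n.+1%:R * x ^+ n)).
Proof.
have := @is_deriveX R _ id n.+1 x 1 1 (is_derive_id _ _).
move=> /(@is_deriveZ R _ _ _ c).
rewrite /GRing.scale /= mulr1 => h.
have -> : (fun y => c * y ^+ n.+1) = (c \*: id ^+ n.+1).
  by apply/funext => y; rewrite /= exprfctE.
exact: h.
Qed.

#[local] Existing Instance is_derive_monomial | 0.

Ltac taylor_step IH := eapply nneg_of_derive; [| |exact: IH];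
  [by rewrite ?sin0 ?cos0; lra|
   by move=> ?; apply: trigger_derive; rewrite /GRing.scale /=; field].

(* Each bound integrates the previous one from [0]. *)
Lemma sin_cos_taylor x : 0 <= x ->
  [/\ x - x ^+ 3 / 6 + x ^+ 5 / 120 - x ^+ 7 / (70 * 72) <= sin x,
      sin x <= x - x ^+ 3 / 6 + x ^+ 5 / 120,
      1 - x ^+ 2 / 2 + x ^+ 4 / 24 - x ^+ 6 / 720 <= cos x &
      cos x <= 1 - x ^+ 2 / 2 + x ^+ 4 / 24 - x ^+ 6 / 720
               + x ^+ 8 / (168 * 240)].
Proof.
have c0 y : 0 <= y -> 0 <= 1 - cos y :> R by rewrite subr_ge0 cos_le1.
have s1 : forall y : R, 0 <= y -> 0 <= y - sin y by taylor_step c0.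
have c2 : forall y : R, 0 <= y -> 0 <= cos y - 1 + 2^-1 * y ^+ 2.
  by taylor_step s1.
have s3 : forall y : R, 0 <= y -> 0 <= sin y - y + 6^-1 * y ^+ 3.
  by taylor_step c2.
have c4 : forall y : R, 0 <= y ->
  0 <= 1 - 2^-1 * y ^+ 2 + 24^-1 * y ^+ 4 - cos y by taylor_step s3.
have s5 : forall y : R, 0 <= y ->
  0 <= y - 6^-1 * y ^+ 3 + 120^-1 * y ^+ 5 - sin y by taylor_step c4.
have c6 : forall y : R, 0 <= y ->
  0 <= cos y - 1 + 2^-1 * y ^+ 2 - 24^-1 * y ^+ 4 + 720^-1 * y ^+ 6.
  by taylor_step s5.
(* Here [70 * 72] is 7!, and [168 * 240] in the next bound is 8!. *)
have s7 : forall y : R, 0 <= y ->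
  0 <= sin y - y + 6^-1 * y ^+ 3 - 120^-1 * y ^+ 5 + (70 * 72)^-1 * y ^+ 7.
  by taylor_step c6.
have c8 : forall y : R, 0 <= y -> 0 <= 1 - 2^-1 * y ^+ 2 + 24^-1 * y ^+ 4
  - 720^-1 * y ^+ 6 + (168 * 240)^-1 * y ^+ 8 - cos y by taylor_step s7.
move=> x0; split.
- by have := s7 x x0; lra.
- by have := s5 x x0; lra.
- by have := c6 x x0; lra.
- by have := c8 x x0; lra.
Qed.

(** The bound 12 / 5 lies below the square root of 6, which keeps the factor [1 - x ^+ 2 / 6]
    positive, and above every [k * x + e] that occurs in [robin]. *)
Lemma sin_gt0_lt x : 0 < x -> x <= 12 / 5 -> 0 < sin x.
Proof.
move=> x0 x1; have [+ _ _ _] := sin_cos_taylor (ltW x0).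
apply: lt_le_trans.
rewrite (_ : _ - _ = x * ((1 - x ^+ 2 / 6) + x ^+ 4 / 120 * (1 - x ^+ 2 / 42))).
  have x2 : x ^+ 2 <= 144 / 25 by nra.
  apply: mulr_gt0 => //; apply: ltr_wpDr; last by lra.
  by apply: mulr_ge0; [rewrite divr_ge0// exprn_even_ge0|lra].
by field.
Qed.

(** In q = x^2 the Taylor bound is reduced to a linear one: q^3 is estimated by q <= 9 / 4, and q^2
    by its tangent at 9 / 4. *)
Lemma cos_gt0_le x : `|x| <= 3 / 2 -> 0 < cos x.
Proof.
move=> x1; rewrite -cos_norm; have [_ _ + _] := sin_cos_taylor (normr_ge0 x).
apply: lt_le_trans; move: x1 (normr_ge0 x); set y := `|x| => y1 y0.
have y2 : 0 <= y ^+ 2 <= 9 / 4 by apply/andP; split; nra.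
have -> : y ^+ 4 = (y ^+ 2) ^+ 2 by rewrite -exprM.
have -> : y ^+ 6 = (y ^+ 2) ^+ 3 by rewrite -exprM.
move: (y ^+ 2) y2 => q /andP[q0 q1].
have q3 : q ^+ 3 <= 9 / 4 * q ^+ 2 by rewrite exprS ler_wpM2r// sqr_ge0.
have q2 : 9 / 2 * q - 81 / 16 <= q ^+ 2.
  by rewrite -subr_ge0 (_ : _ - _ = (q - 9 / 4) ^+ 2) ?sqr_ge0//; field.
lra.
Qed.

(** The equation x + tan x = 0, with x = 1 / (2 mu), multiplied by cos x to remove the poles. *)
Let h x := x * cos x + sin x.

Let dh x : is_derive x 1 h (2 * cos x - x * sin x).
Proof. by apply: trigger_derive; rewrite /GRing.scale /=; ring. Qed.

(** Near 2 the Taylor bounds are too coarse for the bracket below; at a quarter of the angle they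
    are sharp enough. *)
Let sin_quad x : sin x = 4 * sin (x / 4) * cos (x / 4) * (2 * cos (x / 4) ^+ 2 - 1).
Proof.
rewrite {1}(_ : x = (x / 4) *+ 2 *+ 2); last by rewrite !mulr2n; field.
by rewrite !(sin_mulr2n, cos_mulr2n) !mulr2n; ring.
Qed.

Let cos_quad x : cos x = 2 * (2 * cos (x / 4) ^+ 2 - 1) ^+ 2 - 1.
Proof.
rewrite {1}(_ : x = (x / 4) *+ 2 *+ 2); last by rewrite !mulr2n; field.
by rewrite !cos_mulr2n !mulr2n; ring.
Qed.

(** The end points are simple fractions on either side of k that lie between 1 / (2 * 0.24647) and 1
    / (2 * 0.24641). *)
Let root_bracket : 0 < h (637 / 314) /\ h (140 / 69) < 0.
Proof.
split; rewrite /h cos_quad sin_quad.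
  set y := 637 / 314 / 4.
  have [|s0 _ c0 _] := @sin_cos_taylor y; first by rewrite /y; lra.
  (* This and the following fractions round the Taylor values and their products in the safe
     direction, keeping the numbers small. *)
  have {}s0 : 713 / 1468 <= sin y by apply: le_trans s0; rewrite /y; lra.
  have {}c0 : 1243 / 1422 <= cos y by apply: le_trans c0; rewrite /y; lra.
  have sc : 453 / 1067 <= sin y * cos y.
    by apply: (@le_trans _ _ (713 / 1468 * (1243 / 1422)));
      [lra|apply: ler_pM; lra].
  have d0 : 703 / 1331 <= 2 * cos y ^+ 2 - 1 by nra.
  set d := 2 * _ - 1 in d0 *.
  have d2 : 703 / 1331 * (703 / 1331) <= d ^+ 2.
    by rewrite expr2; apply: ler_pM; lra.
  have scd : 453 / 1067 * (703 / 1331) <= sin y * cos y * d.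
    by apply: ler_pM; lra.
  lra.
set y := 140 / 69 / 4.
have [|s0 s1 c0 c1] := @sin_cos_taylor y; first by rewrite /y; lra.
have {}s0 : 0 <= sin y by apply: le_trans s0; rewrite /y; lra.
have {}c0 : 8 / 10 <= cos y by apply: le_trans c0; rewrite /y; lra.
have {}s1 : sin y <= 461 / 949 by apply: (le_trans s1); rewrite /y; lra.
have {}c1 : cos y <= 1076 / 1231 by apply: (le_trans c1); rewrite /y; lra.
have sc : sin y * cos y <= 597 / 1406.
  by apply: (@le_trans _ _ (461 / 949 * (1076 / 1231))); [apply: ler_pM|]; lra.
have sc0 : 0 <= sin y * cos y by apply: mulr_ge0; lra.
have d0 : 2 * cos y ^+ 2 - 1 <= 687 / 1301 by nra.
have d1 : 0 <= 2 * cos y ^+ 2 - 1 by nra.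
set d := 2 * _ - 1 in d0 d1 *.
have d2 : d ^+ 2 <= 687 / 1301 * (687 / 1301).
  by rewrite expr2; apply: ler_pM; lra.
have scd : sin y * cos y * d <=
    597 / 1406 * (687 / 1301).
  by apply: ler_pM; lra.
lra.
Qed.

(** On (0, pi / 2] the cosine term is nonnegative and the sine positive. Between pi / 2 and k the
    cosine is negative and the sine positive, so [h] has negative derivative and decreases to its
    zero at k. *)
Lemma transcendental_root : exists k : R,
  [/\ 637 / 314 < k < 140 / 69, k * cos k + sin k = 0 &
      forall x, 0 < x -> x < k -> 0 < x * cos x + sin x].
Proof.
have [h0 h1] := root_bracket.
have ch : continuous h by move=> x; exact: is_derive_continuous (dh x).
have [||k] := @IVT R h (637 / 314) (140 / 69) 0 _ (continuous_subspaceT ch).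
- lra.
- by rewrite ge_min le_max (ltW h0) (ltW h1) orbT.
rewrite in_itv/= => /andP[k0 k1] hk; exists k.
have {}k0 : 637 / 314 < k.
  rewrite lt_neqAle k0 andbT; apply: contraTneq h0 => ->.
  by rewrite hk ltxx.
have {}k1 : k < 140 / 69.
  rewrite lt_neqAle k1 andbT; apply: contraTneq h1 => <-.
  by rewrite hk ltxx.
split=> //; first by rewrite k0.
move=> x x0 xk.
have [xpi|pix] := leP x (pi / 2).
  apply: ltr_wpDl; last by apply: sin_gt0_lt; lra.
  rewrite mulr_ge0 ?(ltW x0)// cos_ge0_pihalf// xpi andbT.
  by have := pi_gt0 R; lra.
have [c] := MVT xk (fun y _ => dh y) (continuous_subspaceT ch).
rewrite in_itv/= hk => /andP[xc ck] E.
have cc : cos c < 0.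
  rewrite -(subrK (pi / 2) c) cosDpihalf oppr_lt0.
  apply: sin_gt0_lt; first by lra.
  by have := pi_gt0 R; lra.
have sc : 0 < sin c by apply: sin_gt0_lt; lra.
have : 0 < (c * sin c - 2 * cos c) * (k - x).
  apply: mulr_gt0; last by lra.
  have : 0 < c * sin c by apply: mulr_gt0 => //; lra.
  lra.
rewrite -/(h x); lra.
Qed.

End TrigBounds.

(** * One-dimensional inequalities *)

Section OneDimensional.
Context {R : realType}.
Implicit Types (f g F G A a psi : R -> R).

(* [a] is the derivative of [f] in the sense of integration by parts. *)
Definition wder f a : Prop := [/\ {within `[0, 1], continuous f}, bmeas a &
  forall F F', C1on F F' ->
    int01 (fun x => f x * F' x) = f 1 * F 1 - f 0 * F 0 - int01 (fun x => a x * F x)].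

Lemma wder_bmeas f a : wder f a -> bmeas f.
Proof. by move=> [cf _ _]; exact: within_continuous_bmeas. Qed.

Lemma wder_C1on F f : C1on F f -> wder F f.
Proof.
move=> CF; split; [exact: C1on_continuous CF|exact: bmeasC1' CF|].
move=> G G' CG; have := int01_FTC (C1onM CF CG).
have [? ?] := (bmeasC1 CF, bmeasC1' CF).
have [? ?] := (bmeasC1 CG, bmeasC1' CG).
by rewrite int01D; [move=> ?; lra|bmeas_tac..].
Qed.

Lemma wderB f a g b : wder f a -> wder g b ->
  wder (fun x => f x - g x) (fun x => a x - b x).
Proof.
move=> wf wg; have [mf mg] := (wder_bmeas wf, wder_bmeas wg).
case: wf => cf ma If; case: wg => cg mb Ig; split.
- by move=> x; apply: cvgB; [exact: cf|exact: cg].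
- exact: bmeasB.
move=> F F' CF; have [? ?] := (bmeasC1 CF, bmeasC1' CF).
under eq_int01 do rewrite mulrBl.
under [in RHS]eq_int01 do rewrite mulrBl.
by rewrite !int01B ?(If _ _ CF) ?(Ig _ _ CF); [ring|bmeas_tac..].
Qed.

(* Integrate [(f - psi F)^2 >= 0]. *)
Lemma riccati F f psi psi' (l : R) : C1on F f -> C1on psi psi' ->
  (forall x, x \in `[0, 1] -> psi' x + psi x ^+ 2 <= - l) ->
  l * int01 (fun x => F x ^+ 2) + psi 1 * F 1 ^+ 2 - psi 0 * F 0 ^+ 2 <=
  int01 (fun x => f x ^+ 2).
Proof.
move=> CF Cp ric.
have Cq := C1onM Cp (C1onM CF CF).
have [? ?] := (bmeasC1 CF, bmeasC1' CF).
have [? ?] := (bmeasC1 Cq, bmeasC1' Cq).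
have := int01_FTC Cq; rewrite -!expr2 => E.
suff : 0 <= int01 (fun x => f x ^+ 2 - l * F x ^+ 2 -
    (psi' x * (F x * F x) + psi x * (f x * F x + F x * f x))).
  by rewrite int01B ?int01B ?int01Zl; [lra|bmeas_tac..].
apply: int01_ge0 => x x01.
rewrite (_ : _ - _ = (f x - psi x * F x) ^+ 2 +
  (- l - (psi' x + psi x ^+ 2)) * F x ^+ 2); last by ring.
by rewrite addr_ge0 ?sqr_ge0// mulr_ge0 ?sqr_ge0// subr_ge0 ric.
Qed.

(* [psi = - 3 tan (3 (x - 1 / 2))] satisfies [psi' + psi^2 = - 9]. *)
Lemma dirichlet9 F f : C1on F f -> F 0 = 0 -> F 1 = 0 ->
  9 * int01 (fun x => F x ^+ 2) <= int01 (fun x => f x ^+ 2).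
Proof.
move=> CF F0 F1.
pose psi x := - 3 * tan (3 * (x - 1 / 2)) : R.
pose psi' x := - 9 - psi x ^+ 2 : R.
have cos0 x : x \in `[0, 1] -> cos (3 * (x - 1 / 2)) != 0 :> R.
  rewrite in_itv/= => /andP[x0 x1]; rewrite gt_eqF// cos_gt0_le//.
  by rewrite ler_norml; apply/andP; split; lra.
have dpsi (x : R) : x \in `[0, 1] -> is_derive x 1 psi (psi' x).
  move=> /cos0 cx; have := is_derive_tan cx => dt.
  have dl : is_derive x 1 (fun y : R => 3 * (y - 1 / 2)) 3.
    by apply: trigger_derive; rewrite /GRing.scale /=; ring.
  have dc := @is_derive1_comp R tan (fun y => 3 * (y - 1 / 2)) x _ _ dt dl.
  have := @is_deriveZ R _ _ _ (- 3) x 1 _ dc.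
  rewrite (_ : - 3 *: _ = psi' x)//.
  by rewrite (cos2_tan2 cx) /psi' /psi /GRing.scale/=; ring.
have Cpsi : C1on psi psi'.
  split=> //; apply/continuous_in_subspaceT => x /[!inE] x01.
  have cp := is_derive_continuous (dpsi x x01).
  by apply: cvgB; [exact: cvg_cst|exact: (cvgM cp cp)].
have := @riccati F f psi psi' 9 CF Cpsi.
rewrite F0 F1 expr0n/= !mulr0 subr0 addr0; apply => x _.
by rewrite /psi' subrK.
Qed.

(* Integrate [(a + 9 F)^2 >= 0], with [F] the primitive of [f - int01 f]. *)
Lemma wirtinger9 f a : wder f a ->
  9 * (int01 (fun x => f x ^+ 2) - int01 f ^+ 2) <= int01 (fun x => a x ^+ 2).
Proof.
move=> wf; have mf := wder_bmeas wf; case: wf => cf ma If.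
set m := int01 f.
have [G CG] : exists G, C1on G (fun x => f x - m).
  by apply: C1on_primitive => x; apply: cvgB; [exact: cf|exact: cvg_cst].
have CF : C1on (fun x => G x - G 0) (fun x => f x - m).
  by have := C1onD CG (C1on_cst (- G 0)); apply: eq_C1on => x _; rewrite addr0.
have G1 : G 1 - G 0 = 0.
  rewrite -(int01_FTC CG) int01B// ?int01_cst ?subrr//; exact: bmeas_cst.
have [mF _] := (bmeasC1 CF, bmeasC1' CF).
have E1 : int01 (fun x => (f x - m) ^+ 2) = int01 (fun x => f x ^+ 2) - m ^+ 2.
  transitivity (int01 (fun x => f x ^+ 2 - 2 * m * f x + m ^+ 2)).
    by apply: eq_int01 => x _; ring.
  by rewrite int01D ?int01B ?int01Zl ?int01_cst -/m; [ring|bmeas_tac..].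
(* The primitive vanishes at both ends, so integration by parts leaves no boundary term. *)
have E2 : int01 (fun x => a x * (G x - G 0)) = - (int01 (fun x => f x ^+ 2) - m ^+ 2).
  have := If _ _ CF; rewrite G1 subrr !mulr0 subr0 sub0r.
  rewrite (_ : int01 _ = int01 (fun x => f x ^+ 2 - m * f x)); last first.
    by apply: eq_int01 => x _; ring.
  by rewrite int01B ?int01Zl -/m; [move=> h; lra|bmeas_tac..].
have D9 := dirichlet9 CF (subrr _) G1; rewrite E1 in D9.
have : 0 <= int01 (fun x => (a x + 9 * (G x - G 0)) ^+ 2).
  by apply: int01_ge0 => x _; exact: sqr_ge0.
rewrite (_ : int01 _ = int01 (fun x => a x ^+ 2 + 18 * (a x * (G x - G 0)) +
  81 * (G x - G 0) ^+ 2)); last by apply: eq_int01 => x _; ring.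
have ? : bmeas (fun x => a x * (G x - G 0)) by bmeas_tac.
have ? : bmeas (fun x => (G x - G 0) ^+ 2) by bmeas_tac.
rewrite int01D ?int01D ?int01Zl ?E2; [lra|bmeas_tac..].
Qed.

End OneDimensional.

(** * Affine substitutions on the unit interval *)

Section Substitution.
Context {R : realType}.
Implicit Types (f F : R -> R).

Lemma C1on_affine (b c : R) F f :
  (forall x : R, x \in `[0, 1] -> b * x + c \in `[0, 1]) -> C1on F f ->
  C1on (fun x => F (b * x + c)) (fun x => b * f (b * x + c)).
Proof.
move=> bc [cf dF].
have dl (x : R) : is_derive x 1 (fun y : R => b * y + c) b.
  by apply: trigger_derive; rewrite /GRing.scale /=; ring.
split=> [|x x01].
  suff cg : {within `[0, 1], continuous (fun x => f (b * x + c))}.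
    by move=> x; apply: cvgM; [exact: cvg_cst|exact: cg].
  apply/subspace_continuousP => x x01.
  apply: (@cvg_comp _ _ _ (fun y => b * y + c) f _
    (within `[0, 1] (nbhs (b * x + c)))).
    move=> P /= /(is_derive_continuous (dl x)) Px.
    apply: (@filterS _ (nbhs x)) Px => y /= Py y01; apply: Py; exact: bc.
  by move/subspace_continuousP : cf; apply; exact: bc.
have := @is_derive1_comp R F (fun y => b * y + c) x _ _ (dF _ (bc _ x01)) (dl x).
by rewrite mulrC.
Qed.

Lemma flip01 (x : R) : x \in `[0, 1] -> -1 * x + 1 \in `[0, 1].
Proof. by rewrite !in_itv/= => /andP[? ?]; apply/andP; split; lra. Qed.

Lemma C1on_flip F f : C1on F f ->
  C1on (fun x => F (-1 * x + 1)) (fun x => -1 * f (-1 * x + 1)).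
Proof. exact: (C1on_affine flip01). Qed.

Lemma int01_reflect f : {within `[0, 1], continuous f} ->
  int01 (fun x => f (1 - x)) = int01 f.
Proof.
move=> /C1on_primitive[F CF].
have := C1onZ (-1) (C1on_flip CF) => /int01_FTC.
rewrite (int01_FTC CF) mulr0 add0r mulr1 addNr => h.
apply: etrans (_ : _ = -1 * F 0 - -1 * F 1) _; last by ring.
rewrite -h; apply: eq_int01 => x _; rewrite mulrA mulrNN !mul1r.
by congr f; ring.
Qed.

Let half01 (s x : R) : (s = 1 / 2 \/ s = - (1 / 2)) -> x \in `[0, 1] ->
  s * x + 1 / 2 \in `[0, 1].
Proof.
by rewrite !in_itv/= => -[->|->] /andP[? ?]; apply/andP; split; lra.
Qed.

Lemma C1on_half F f (s : R) : (s = 1 / 2 \/ s = - (1 / 2)) -> C1on F f ->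
  C1on (fun x => F (s * x + 1 / 2)) (fun x => s * f (s * x + 1 / 2)).
Proof. by move=> s12; apply: C1on_affine => x; exact: half01. Qed.

(** The interval is cut at its midpoint and each half is parametrized outwards from 1 / 2. In
    [robin_mean] this makes the even and odd parts about 1 / 2 orthogonal. *)
Lemma int01_fold f : {within `[0, 1], continuous f} ->
  int01 (fun x => (f (1 / 2 * x + 1 / 2) + f (- (1 / 2) * x + 1 / 2)) / 2) = int01 f.
Proof.
move=> /C1on_primitive[F CF].
have Cp := C1on_half (or_introl erefl) CF.
have Cm := C1onZ (-1) (C1on_half (or_intror erefl) CF).
have := int01_FTC (C1onD Cp Cm); rewrite (int01_FTC CF) => h.
transitivity (int01 (fun x => 1 / 2 * f (1 / 2 * x + 1 / 2) +
  -1 * (- (1 / 2) * f (- (1 / 2) * x + 1 / 2)))).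
  by apply: eq_int01 => x _; field.
rewrite h !mulr0 !mulr1 !add0r.
have -> : 1 / 2 + 1 / 2 = 1 :> R by field.
by rewrite addNr; ring.
Qed.

End Substitution.

(** * Robin inequalities and the Poincare inequalities dual to them *)

Section Robin.
Context {R : realType}.
Variable k : R.
(** The upper bound keeps k + 1 / 4 below 12 / 5, for [sin_gt0_lt], and 4 k^2 below 18, for
    [poincare_of]. *)
Hypotheses (k_bounds : 2 < k < 21 / 10) (k_root : k * cos k + sin k = 0).
Implicit Types (F f A a : R -> R).

Let sin_shift_gt0 (e x : R) : 0 < e -> e < 1 / 4 -> x \in `[0, 1] ->
  0 < sin (k * x + e).
Proof.
rewrite in_itv/= => e0 e1 /andP[x0 x1]; have /andP[k0 k1] := k_bounds.
have kx : 0 <= k * x by rewrite mulr_ge0//; lra.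
have kx1 : k * x <= k by rewrite ler_piMr//; lra.
by apply: sin_gt0_lt; lra.
Qed.

(* [psi = k cot (k x + e)] satisfies [psi' + psi^2 = - k^2]; the shift [e > 0]
   keeps it regular at [0] and [psi 1] tends to [k cot k = - 1] with [e]. *)
Lemma robin F f : C1on F f -> F 0 = 0 ->
  k ^+ 2 * int01 (fun x => F x ^+ 2) <= int01 (fun x => f x ^+ 2) + F 1 ^+ 2.
Proof.
move=> CF F0.
have shifted (e : R) : 0 < e -> e < 1 / 4 ->
    k ^+ 2 * int01 (fun x => F x ^+ 2) + k * (cos (k + e) / sin (k + e)) * F 1 ^+ 2
    <= int01 (fun x => f x ^+ 2).
  move=> e0 e1.
  pose psi x := k * (cos (k * x + e) / sin (k * x + e)) : R.
  pose psi' x := - k ^+ 2 - psi x ^+ 2 : R.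
  have dpsi (x : R) : x \in `[0, 1] -> is_derive x 1 psi (psi' x).
    move=> x01; have s0 := sin_shift_gt0 e0 e1 x01.
    have dl : is_derive x 1 (fun y : R => k * y + e) k.
      by apply: trigger_derive; rewrite /GRing.scale /=; ring.
    have dc := @is_derive1_comp R cos (fun y => k * y + e) x _ _ (is_derive_cos _) dl.
    have ds := @is_derive1_comp R sin (fun y => k * y + e) x _ _ (is_derive_sin _) dl.
    have dV := @is_deriveV R _ x _ _ (lt0r_neq0 s0) ds.
    have := @is_deriveZ R _ _ _ k x 1 _ (is_deriveM dc dV).
    rewrite (_ : k *: _ = psi' x)//.
    rewrite /psi' /psi /GRing.scale/=.
    by field; rewrite lt0r_neq0.
  have Cpsi : C1on psi psi'.
    split=> //; apply/continuous_in_subspaceT => x /[!inE] x01.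
    have cp := is_derive_continuous (dpsi x x01).
    by apply: cvgB; [exact: cvg_cst|exact: (cvgM cp cp)].
  have := @riccati R F f psi psi' (k ^+ 2) CF Cpsi.
  have -> : psi 1 = k * (cos (k + e) / sin (k + e)) by rewrite /psi mulr1.
  rewrite F0 expr0n/= !mulr0 subr0; apply => x _.
  by rewrite /psi' subrK.
have /andP[k0 k1] := k_bounds.
have sk : 0 < sin k by apply: sin_gt0_lt; lra.
pose g (e : R) := k ^+ 2 * int01 (fun x => F x ^+ 2) +
  k * (cos (k + e) / sin (k + e)) * F 1 ^+ 2.
have cg : {for 0, continuous g}.
  have ck : {for 0, continuous (fun e : R => k + e)}.
    by apply: cvgD; [exact: cvg_cst|exact: cvg_id].
  apply: cvgD; first exact: cvg_cst.
  apply: cvgM; last exact: cvg_cst.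
  apply: cvgM; first exact: cvg_cst.
  apply: cvgM.
    by apply: (continuous_comp ck); exact: continuous_cos.
  apply: cvgV; first by rewrite addr0 lt0r_neq0.
  by apply: (continuous_comp ck); exact: continuous_sin.
have : g 0 <= int01 (fun x => f x ^+ 2).
  apply: (cvgr_to_le (cvg_at_right_filter cg)).
  near=> e; apply: shifted; near: e; first exact: nbhs_right_gt.
  by apply: nbhs_right_lt; lra.
rewrite /g addr0 (_ : k * (cos k / sin k) = - 1); first by lra.
apply: (mulIf (lt0r_neq0 sk)). rewrite mulN1r mulrA mulfVK ?lt0r_neq0//. 
by apply/eqP; rewrite -addr_eq0 k_root.
Unshelve. all: by end_near. Qed.

Lemma robin_left F f : C1on F f -> F 1 = 0 ->
  k ^+ 2 * int01 (fun x => F x ^+ 2) <= int01 (fun x => f x ^+ 2) + F 0 ^+ 2.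
Proof.
move=> CF F1.
have := robin (C1on_flip CF).
rewrite mulr0 add0r mulr1 addNr => /(_ F1).
have sq (g : R -> R) : {within `[0, 1], continuous g} -> int01 (fun x => g (- 1 * x + 1) ^+ 2) =
    int01 (fun x => g x ^+ 2).
  move=> cg; rewrite -(@int01_reflect _ (fun x => g x ^+ 2)).
    by apply: eq_int01 => x _; congr (g _ ^+ 2); ring.
  by move=> x; exact: (cvgM (cg x) (cg x)).
rewrite (sq F (C1on_continuous CF)).
rewrite (_ : int01 (fun x => (-1 * _) ^+ 2) = int01 (fun x => f x ^+ 2)); first by [].

rewrite -(sq f CF.1); apply: eq_int01 => x _.
by rewrite exprMn sqrrN expr1n mul1r.
Qed.

(** Split [F] into its even and odd parts [E] and [O] about 1 / 2, rescaled to [0, 1]; the factor 4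
    comes from the rescaling. The odd part vanishes at the midpoint and obeys [robin]; the even part
    has mean zero and obeys [wirtinger9], which is more than enough because k^2 <= 9. *)
Lemma robin_mean F f : C1on F f -> int01 F = 0 ->
  4 * k ^+ 2 * int01 (fun x => F x ^+ 2) <=
  int01 (fun x => f x ^+ 2) + (F 1 - F 0) ^+ 2.
Proof.
move=> CF IF0.
have Cp := C1on_half (or_introl erefl) CF.
have Cm := C1on_half (or_intror erefl) CF.
have CE := C1onZ (1 / 2) (C1onD Cp Cm).
have CO := C1onZ (1 / 2) (C1onD Cp (C1onZ (-1) Cm)).
set E := (fun x => _) in CE; set e := (fun x => _) in CE.
set O := (fun x => _) in CO; set o := (fun x => _) in CO.
have O0 : O 0 = 0 by rewrite /O !mulr0 add0r; ring.
have O1 : O 1 = (F 1 - F 0) / 2.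
  rewrite /O !mulr1 (_ : 1 / 2 + 1 / 2 = 1); last by field.
  by rewrite addNr; field.
have cF := C1on_continuous CF.
have IE : int01 E = 0.
  by rewrite -IF0 -(int01_fold cF); apply: eq_int01 => x _; rewrite /E; field.
have sqc (g : R -> R) : {within `[0, 1], continuous g} ->
    {within `[0, 1], continuous (fun x => g x ^+ 2)}.
  by move=> cg x; exact: (cvgM (cg x) (cg x)).
have [[mE me] [mO mo]] := ((bmeasC1 CE, bmeasC1' CE), (bmeasC1 CO, bmeasC1' CO)).
have IF2 : int01 (fun x => F x ^+ 2) =
    int01 (fun x => E x ^+ 2) + int01 (fun x => O x ^+ 2).
  rewrite -int01D; [|bmeas_tac..].
  rewrite -(int01_fold (sqc _ cF)); apply: eq_int01 => x _.
  by rewrite /E /O; field.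
have If2 : int01 (fun x => f x ^+ 2) =
    4 * (int01 (fun x => e x ^+ 2) + int01 (fun x => o x ^+ 2)).
  rewrite -int01D -?int01Zl; [|bmeas_tac..].
  rewrite -(int01_fold (sqc _ CF.1)); apply: eq_int01 => x _.
  by rewrite /e /o; field.
have W := wirtinger9 (wder_C1on CE); rewrite IE in W.
have Rb := robin CO O0; rewrite O1 in Rb.
have : 0 <= (36 - 4 * k ^+ 2) * int01 (fun x => E x ^+ 2).
  apply: mulr_ge0; last by apply: int01_ge0 => x _; exact: sqr_ge0.
  have /andP[? ?] := k_bounds; nra.
rewrite IF2 If2; lra.
Qed.

(* With [J = int A^2 - c^2 / 2], integration by parts gives [int a F = - J]
   and the hypothesis says [l int F^2 <= J]; integrate [(a + l F)^2]. *)
Lemma dual_poincare (l : R) A a F : 0 <= l -> wder A a ->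
  C1on F (fun x => A x - int01 A / 2) -> A 1 * F 1 - A 0 * F 0 = 0 ->
  l * int01 (fun x => F x ^+ 2) <=
    int01 (fun x => (A x - int01 A / 2) ^+ 2) + (F 1 - F 0) ^+ 2 ->
  l * (int01 (fun x => A x ^+ 2) - int01 A ^+ 2 / 2) <= int01 (fun x => a x ^+ 2).
Proof.
move=> l0 wA CF bd pc; have mA := wder_bmeas wA; case: wA => cA ma IA.
have mF := bmeasC1 CF.
set c := int01 A in CF pc *; set S := int01 (fun x => A x ^+ 2).
(* The boundary term is thus c^2 / 4, which completes [S - 3 / 4 * c ^+ 2] to J. *)
have F10 : F 1 - F 0 = c / 2.
  by rewrite -(int01_FTC CF) int01B ?int01_cst -/c; [field|bmeas_tac..].
have E1 : int01 (fun x => (A x - c / 2) ^+ 2) = S - 3 / 4 * c ^+ 2.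
  transitivity (int01 (fun x => A x ^+ 2 - c * A x + c ^+ 2 / 4)).
    by apply: eq_int01 => x _; field.
  by rewrite int01D ?int01B ?int01Zl ?int01_cst -/c -/S; [field|bmeas_tac..].
have E2 : int01 (fun x => a x * F x) = - (S - c ^+ 2 / 2).
  have := IA _ _ CF; rewrite bd sub0r.
  rewrite (_ : int01 _ = int01 (fun x => A x ^+ 2 - c / 2 * A x)); last first.
    by apply: eq_int01 => x _; ring.
  by rewrite int01B ?int01Zl -/c -/S; [move=> h; lra|bmeas_tac..].
rewrite E1 F10 in pc.
have : 0 <= int01 (fun x => (a x + l * F x) ^+ 2).
  by apply: int01_ge0 => x _; exact: sqr_ge0.
rewrite (_ : int01 _ = int01 (fun x => a x ^+ 2 + 2 * l * (a x * F x) +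
  l ^+ 2 * F x ^+ 2)); last by apply: eq_int01 => x _; ring.
rewrite int01D ?int01D ?int01Zl ?E2; [|bmeas_tac..].
move=> h; have : l * (l * int01 (fun x => F x ^+ 2)) <= l * (S - c ^+ 2 / 2).
  by rewrite ler_wpM2l//; lra.
lra.
Qed.

Let primitive A a (d : R) : wder A a -> exists2 F : R -> R,
  C1on F (fun x => A x - int01 A / 2) & F 0 = d.
Proof.
move=> [cA _ _].
have [G CG] : exists G, C1on G (fun x => A x - int01 A / 2).
  by apply: C1on_primitive => x; apply: cvgB; [exact: cA|exact: cvg_cst].
exists (fun x => G x + (d - G 0)); last by ring.
by have := C1onD CG (C1on_cst (d - G 0)); apply: eq_C1on => x _; rewrite addr0.
Qed.

Let k2_ge0 : 0 <= k ^+ 2. Proof. exact: sqr_ge0. Qed.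

(** Taking [F 0 = 0] kills the boundary term at the end where [A] is free, and it is the end
    condition of [robin]. *)
Lemma poincare_right A a : wder A a -> A 1 = 0 ->
  k ^+ 2 * (int01 (fun x => A x ^+ 2) - int01 A ^+ 2 / 2) <=
  int01 (fun x => a x ^+ 2).
Proof.
move=> wA A1; have [F CF F0] := primitive 0 wA.
apply: (dual_poincare k2_ge0 wA CF); first by rewrite A1 F0 mul0r mulr0 subr0.
by rewrite F0 subr0; exact: robin CF F0.
Qed.

Lemma poincare_left A a : wder A a -> A 0 = 0 ->
  k ^+ 2 * (int01 (fun x => A x ^+ 2) - int01 A ^+ 2 / 2) <=
  int01 (fun x => a x ^+ 2).
Proof.
(* As [F] grows by [int01 A / 2], this initial value makes it vanish at 1. *)
move=> wA A0; have [F CF F0] := primitive (- (int01 A / 2)) wA.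
have F1 : F 1 = 0.
  have := int01_FTC CF; have mA := wder_bmeas wA.
  by rewrite F0 int01B ?int01_cst; [move=> h; lra|bmeas_tac..].
apply: (dual_poincare k2_ge0 wA CF); first by rewrite A0 F1 mul0r mulr0 subr0.
by rewrite F1 sub0r sqrrN; exact: robin_left CF F1.
Qed.

(** Both boundary terms vanish through [A], so the additive constant of [F] is free; it is fixed by
    the mean-zero condition of [robin_mean]. *)
Lemma poincare_both A a : wder A a -> A 0 = 0 -> A 1 = 0 ->
  4 * k ^+ 2 * (int01 (fun x => A x ^+ 2) - int01 A ^+ 2 / 2) <=
  int01 (fun x => a x ^+ 2).
Proof.
move=> wA A0 A1; have [G CG G0] := primitive 0 wA.
have mG := bmeasC1 CG.
have CF : C1on (fun x => G x - int01 G) (fun x => A x - int01 A / 2).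
  by have := C1onD CG (C1on_cst (- int01 G)); apply: eq_C1on => x _; rewrite addr0.
apply: (dual_poincare _ wA CF); first by rewrite mulr_ge0.
  by rewrite A0 A1 !mul0r subr0.
apply: robin_mean CF _.
by rewrite int01B ?int01_cst ?subrr; bmeas_tac.
Qed.

End Robin.

(** * Reflection across the hypotenuse *)

Section Kernel.
Context {R : realType}.
Implicit Types (f F : R -> R).

Lemma int01_split (p : R) F1 f1 F2 f2 : p \in `[0, 1] -> C1on F1 f1 -> C1on F2 f2 ->
  int01 (fun x => if x < p then f1 x else f2 x) = F1 p - F1 0 + (F2 1 - F2 p).
Proof.
rewrite in_itv/= => /andP[p0 p1] C1 C2.
have m1 := bmeasC1' C1; have m2 := bmeasC1' C2.
have mf := bmeas_if_lt p m1 m2.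
have sub1 : `[0, p[ `<=` (`[0, 1] : set R).
  by move=> x /=; rewrite !in_itv/= => /andP[-> /ltW xp]; exact: le_trans p1.
have sub2 : `[p, 1] `<=` (`[0, 1] : set R).
  by move=> x /=; rewrite !in_itv/= => /andP[px ->]; rewrite (le_trans p0).
have E : `[0, 1]%classic = `[0, p[%classic `|` `[p, 1]%classic :> set R.
  rewrite -(@itv_bndbnd_setU _ _ (BLeft 0) (BLeft p) (BRight 1)) ?bnd_simp//.
rewrite /int01 {1}E Rintegral_setU//; first last.
- apply/disj_setPS => x [/=]; rewrite !in_itv/= => /andP[_ xp] /andP[px _].
  by move: (lt_le_trans xp px); rewrite ltxx.
- by rewrite -E; exact: bmeas_integrable.
rewrite -(FTC (lexx 0) p0 p1 C1) -(FTC p0 p1 (lexx 1) C2); congr (_ + _).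
  rewrite -Rintegral_itv_bndo_bndc; last first.
    by apply: integrableS (bmeas_integrable m1).
  by apply: eq_Rintegral => x; rewrite inE/= in_itv/= => /andP[_ ->].
by apply: eq_Rintegral => x; rewrite inE/= in_itv/= => /andP[px _]; rewrite ltNge px.
Qed.

Variables (h h1 h2 : R -> R -> R).
Hypotheses (ch : continuous (fun z : R * R => h z.1 z.2))
  (ch1 : continuous (fun z : R * R => h1 z.1 z.2))
  (ch2 : continuous (fun z : R * R => h2 z.1 z.2)).
Hypotheses (dh1 : forall x y : R, is_derive x 1 (h ^~ y) (h1 x y))
  (dh2 : forall x y : R, is_derive y 1 (h x) (h2 x y)).

Let U x p := h (Num.min x p) (Num.max x p).
(** Beyond the diagonal [x] is the larger variable, hence the second argument of [h]: its derivative
    there is [h2]. *)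
Let W x p := if x < p then h1 x p else h2 p x.
Let A x := int01 (U x).
Let a x := int01 (W x).

Let UC x p : U x p = U p x. Proof. by rewrite /U minC maxC. Qed.

Let cU : continuous (fun z : R * R => U z.1 z.2).
Proof.
move=> z; apply: (@continuous_comp _ _ _
  (fun z : R * R => (Num.min z.1 z.2, Num.max z.1 z.2)) (fun z => h z.1 z.2)).
  apply: continuous_pair => y.
    by apply: continuous_min; [exact: continuous_fst|exact: continuous_snd].
  by apply: continuous_max; [exact: continuous_fst|exact: continuous_snd].
exact: ch.
Qed.

Let mU : bmeas2 U. Proof. exact: continuous_bmeas2. Qed.

Let mW : bmeas2 W.
Proof.
apply: bmeas2_if_lt; first exact: continuous_bmeas2 ch1.
exact: bmeas2_swap (continuous_bmeas2 ch2).
Qed.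

Let C1h1 y : C1on (h ^~ y) (h1 ^~ y).
Proof. by split=> [|x _//]; apply/continuous_subspaceT/continuous_slice1. Qed.

Let C1h2 x : C1on (h x) (h2 x).
Proof. by split=> [|y _//]; apply/continuous_subspaceT/continuous_slice2. Qed.

(** Integrate by parts on both sides of [x = p]. The inner boundary terms cancel because both pieces
    of [U] equal [h p p] there. *)
Let slice p : p \in `[0, 1] -> wder (U ^~ p) (W ^~ p).
Proof.
move=> p01; have mWp := bmeas2_slice p01 (bmeas2_swap mW).
have cUp := continuous_slice1 (y := p) cU.
split=> //; first exact: continuous_subspaceT.
move=> F F' CF; have mF := bmeasC1 CF; have mF' := bmeasC1' CF.
have mUp := continuous_bmeas cUp.
have := int01_split p01 (C1onM (C1h1 p) CF) (C1onM (C1h2 p) CF).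
rewrite (_ : int01 _ = int01 (fun x => U x p * F' x + W x p * F x)); last first.
  by apply: eq_int01 => x _; rewrite /U /W; case: ltP => _; ring.
rewrite int01D; [|bmeas_tac..].
move: (p01); rewrite in_itv/= => /andP[p0 p1].
have -> : U 1 p = h p 1 by rewrite /U min_r// max_l.
have -> : U 0 p = h 0 p by rewrite /U min_l// max_r.
lra.
Qed.

Let cA : {within `[0, 1], continuous A}.
Proof.
apply/continuous_in_subspaceT => x /[!inE]; rewrite /= in_itv/= => /andP[x0 x1].
(* Continuity under the integral needs a uniform bound on an open neighbourhood of [0, 1];
   [x = 3 * s - 1] carries the bound on the unit square over to [x] in [-1, 2]. *)
pose V (s p : R) := U (3 * s - 1) p.
have cV : continuous (fun z : R * R => V z.1 z.2).
  move=> z; apply: (@continuous_comp _ _ _ (fun z : R * R => (3 * z.1 - 1, z.2))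
    (fun z => U z.1 z.2)); last exact: cU.
  apply: continuous_pair; last exact: continuous_snd.
  move=> y; apply: cvgB; last exact: cvg_cst.
  by apply: cvgM; [exact: cvg_cst|exact: continuous_fst].
have [_ [M VM]] := continuous_bmeas2 cV.
apply: (@continuity_under_integral R _ _ (leb1 R) U `[0, 1] _ (-1) 2 _ _ (fun=> M)).
- exact: measurable_itv.
- by move=> y _; apply/bmeas_integrable/continuous_bmeas/continuous_slice2.
- by apply: nearW => p _ y _; exact: continuous_slice1.
- exact/bmeas_integrable/bmeas_cst.
- move=> y /=; rewrite in_itv/= => /andP[y0 y1]; apply: nearW => p p01.
  have := VM ((y + 1) / 3) p; rewrite /V (_ : 3 * _ - 1 = y); last by field.
  apply => //.
  by rewrite in_itv/=; apply/andP; split; lra.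
- by rewrite inE/= in_itv/=; apply/andP; split; lra.
Qed.

(** The integral over [p] of the identities in [slice], after exchanging the two integrations. *)
Let wA : wder A a.
Proof.
have mA := within_continuous_bmeas cA; have ma := bmeas_int01 mW.
split=> // F F' CF; have mF := bmeasC1 CF; have mF' := bmeasC1' CF.
have mUF' := bmeas2M mU (bmeas2_fst mF'); have mWF := bmeas2M mW (bmeas2_fst mF).
have E (g : R -> R) (G : R -> R -> R) : bmeas g -> bmeas2 G ->
    int01 (fun x => int01 (G x) * g x) = int01 (fun p => int01 (fun x => G x p * g x)).
  move=> mg mG; have := int01_swap (bmeas2M mG (bmeas2_fst mg)) => <-.
  by apply: eq_int01 => x x01; rewrite int01Zr//; exact: bmeas2_slice.
rewrite (E _ _ mF' mU) (E _ _ mF mW).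
have o0 : (0 : R) \in `[0, 1] by rewrite in_itv/= lexx ler01.
have o1 : (1 : R) \in `[0, 1] by rewrite in_itv/= lexx ler01.
have mU1 := bmeas2_slice o1 mU; have mU0 := bmeas2_slice o0 mU.
have mI := bmeas_int01 (bmeas2_swap mWF).
rewrite -!int01Zr// -!int01B; [|bmeas_tac..].
by apply: eq_int01 => p p01; have [_ _ /(_ _ _ CF)->] := slice p01.
Qed.

Let SU := int01 (fun x => int01 (fun p => U x p ^+ 2)).
Let SW := int01 (fun x => int01 (fun p => W x p ^+ 2)).
Let SA := int01 (fun x => A x ^+ 2).
Let Sa := int01 (fun x => a x ^+ 2).
Let c := int01 A.

Let mA : bmeas A. Proof. exact: within_continuous_bmeas. Qed.
Let ma : bmeas a. Proof. by case: wA. Qed.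

(** Pythagoras in the variable [p]: removing the mean of [G x] lowers its mean square by the square
    of that mean. *)
Let sqr_sub_mean (G : R -> R -> R) (g := fun x => int01 (G x)) : bmeas2 G ->
  int01 (fun p => int01 (fun x => (G x p - g x) ^+ 2)) =
  int01 (fun x => int01 (fun p => G x p ^+ 2)) - int01 (fun x => g x ^+ 2).
Proof.
move=> mG; have mg : bmeas g := bmeas_int01 mG.
have mD := bmeas2X 2 (bmeas2B mG (bmeas2_fst mg)).
rewrite -[LHS](int01_swap mD).
rewrite -int01B; [|exact: bmeas_int01 (bmeas2X 2 mG)|bmeas_tac].
apply: eq_int01 => x x01; have mGx := bmeas2_slice x01 mG.
transitivity (int01 (fun p => G x p ^+ 2 - 2 * g x * G x p + g x ^+ 2)).
  by apply: eq_int01 => p _; ring.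
by rewrite int01D ?int01B ?int01Zl ?int01_cst -/(g x); [ring|bmeas_tac..].
Qed.

Let mean_slice p : p \in `[0, 1] -> int01 (fun x => U x p - A x) = A p - c.
Proof.
move=> p01; rewrite int01B//; last exact: bmeas2_slice (bmeas2_swap mU).
by congr (_ - _); apply: eq_int01 => x _; exact: UC.
Qed.

Let int_mean : int01 (fun p => (A p - c) ^+ 2) = SA - c ^+ 2.
Proof.
transitivity (int01 (fun p => A p ^+ 2 - 2 * c * A p + c ^+ 2)).
  by apply: eq_int01 => p _; ring.
by rewrite int01D ?int01B ?int01Zl ?int01_cst -/c -/SA; [ring|bmeas_tac..].
Qed.

(** The slices of [U x p - A x] in [x] have mean [A p - c], by the symmetry of [U]; the square of a
    mean is at most the mean square. *)
Let kernel_variance : 0 <= SU - 2 * SA + c ^+ 2.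
Proof.
have mD := bmeas2B mU (bmeas2_fst mA).
suff : SA - c ^+ 2 <= SU - SA by lra.
rewrite -int_mean -sqr_sub_mean//; apply: ler_int01; first by bmeas_tac.
  exact: bmeas_int01 (bmeas2_swap (bmeas2X 2 mD)).
move=> p p01; rewrite -mean_slice//; apply: sqr_int01_le.
exact: bmeas2_slice (bmeas2_swap mD).
Qed.

Let kernel_energy : Sa + 9 * (SU - 2 * SA + c ^+ 2) <= SW.
Proof.
suff : 9 * ((SU - SA) - (SA - c ^+ 2)) <= SW - Sa by lra.
have mD := bmeas2B mU (bmeas2_fst mA); have mE := bmeas2B mW (bmeas2_fst ma).
have mDI := bmeas_int01 (bmeas2_swap (bmeas2X 2 mD)).
rewrite -int_mean -!sqr_sub_mean// -int01B; [|bmeas_tac..].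
rewrite -int01Zl; [|bmeas_tac..].
apply: ler_int01; first by bmeas_tac.
  exact: bmeas_int01 (bmeas2_swap (bmeas2X 2 mE)).
by move=> p p01; rewrite -mean_slice//; exact: wirtinger9 (wderB (slice p01) wA).
Qed.

Lemma kernel_inequality : exists A a U W,
  [/\ wder A a, A 0 = int01 (h 0), A 1 = int01 (h ^~ 1),
      bmeas2 U /\ (forall x p, x != p -> U x p = if x < p then h x p else h p x) &
      bmeas2 W /\ (forall x p, x != p -> W x p = if x < p then h1 x p else h2 p x)] /\
  (let SU := int01 (fun x => int01 (fun p => U x p ^+ 2)) in
   let D := SU - 2 * int01 (fun x => A x ^+ 2) + int01 A ^+ 2 in
   0 <= D /\ int01 (fun x => a x ^+ 2) + 9 * D <=
             int01 (fun x => int01 (fun p => W x p ^+ 2))).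
Proof.
exists A, a, U, W; split; last by split; [exact: kernel_variance|exact: kernel_energy].
split=> //.
- apply: eq_int01 => p; rewrite in_itv/= => /andP[p0 _].
  by rewrite /U min_l// max_r.
- apply: eq_int01 => p; rewrite in_itv/= => /andP[_ p1].
  by rewrite /U min_r// max_l.
- by split=> // x p; rewrite /U; case: ltgtP.
Qed.

End Kernel.

(** * Integrals over the triangle as iterated integrals *)

Section Triangle.
Context {R : realType}.
Implicit Types (f g : R -> R).

Lemma eq_int01_except (c : R) f g : bmeas f -> bmeas g ->
  (forall x, x \in `[0, 1] -> x != c -> f x = g x) -> int01 f = int01 g.
Proof.
move=> mf mg fg; congr fine; apply: ae_eq_integral => //.
- by apply/measurable_EFinP; exact: mf.1.
- by apply/measurable_EFinP; exact: mg.1.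
exists [set c]; split => //; first exact: lebesgue_measure_set1.
move=> x /= nfg; apply: contrapT => /eqP xc; apply: nfg => x01.
by rewrite fg.
Qed.

Lemma measurable_triangle :
  measurable (@triangle R : set (measurableTypeR R * measurableTypeR R)).
Proof.
have -> : @triangle R = (fst @^-1` `]0, +oo[) `&` (snd @^-1` `]0, +oo[)
    `&` ((fun z : R * R => z.1 + z.2) @^-1` `]-oo, 1[).
  apply/seteqP; split=> z /=; rewrite !in_itv/= !andbT.
    by move=> [? ? ?]; split; first split.
  by move=> [[? ?] ?]; split.
have mI (f : R * R -> R) (I : interval R) : continuous f ->
    measurable (f @^-1` [set` I] : set (measurableTypeR R * measurableTypeR R)).
  move=> /continuous2_measurable mf; rewrite -[X in measurable X]setTI.
  by apply: mf => //; exact: measurable_itv.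
apply: measurableI; first apply: measurableI.
- exact: mI continuous_fst.
- exact: mI continuous_snd.
- apply: (mI (fun z : R * R => z.1 + z.2)) => z.
  by apply: cvgD; [exact: continuous_fst|exact: continuous_snd].
Qed.

Lemma triangle_square : @triangle R `<=` square.
Proof.
by move=> [x y] [/= x0 y0 xy]; split; rewrite /= in_itv/=; apply/andP; split; lra.
Qed.

Lemma leb2_triangle_le1 : (leb2 R (@triangle R) <= 1)%E.
Proof.
rewrite [leRHS](_ : _ = leb2 R square).
  by apply: le_measure; rewrite ?inE; [exact: measurable_triangle|
    exact: measurable_square|exact: triangle_square].
apply/esym; apply: etrans (product_measure1E _ _ _ _) _ => //.
by rewrite [X in (X * X)%E]leb1_itv01 mule1.
Qed.

Variable g : R * R -> R.
Hypothesis cg : continuous g.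

Let gC : R -> R -> R := fun x y => (g \_ (@triangle R)) (x, y).

Lemma bmeas2_continuous : bmeas2 (fun x y => g (x, y)).
Proof.
apply: continuous_bmeas2; rewrite (_ : (fun z => _) = g)//.
by apply/funext => -[].
Qed.

Let mgC : bmeas2 gC.
Proof.
have [mg [M gM]] := bmeas2_continuous.
split.
  rewrite (_ : (fun z => _) = g \_ (@triangle R)); last by apply/funext => -[].
  apply: measurable_funTS; apply/(measurable_restrictT _ measurable_triangle).
  by apply: measurable_funTS; exact: continuous2_measurable.
exists M => x y x01 y01; rewrite /gC patchE; case: ifPn => _; first exact: gM.
by rewrite normr0 (le_trans _ (gM x y x01 y01)).
Qed.

Lemma integrable_triangle :
  (leb2 R).-integrable (@triangle R) (EFin \o g).
Proof.
have [_ [M gM]] := bmeas2_continuous.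
apply: measurable_bounded_integrable.
- exact: measurable_triangle.
- by apply: le_lt_trans leb2_triangle_le1 _; rewrite ltry.
- by apply: measurable_funTS; exact: continuous2_measurable.
- exists M; split; first exact: num_real.
  move=> r /ltW Mr [x y] /triangle_square[x01 y01] /=.
  by rewrite (le_trans _ Mr)// gM.
Qed.

Lemma int01_above (p : R) F f : p \in `[0, 1] -> C1on F f ->
  int01 (fun x => if p < x then f x else 0) = F 1 - F p.
Proof.
move=> p01 CF; have := int01_split p01 (C1on_cst 0) CF.
have mf := bmeasC1' CF.
rewrite subrr add0r => <-; apply: (@eq_int01_except p).
- exact: bmeas_if_gt mf (bmeas_cst 0).
- exact: bmeas_if_lt (bmeas_cst 0) mf.
- by move=> x _; case: ltgtP.
Qed.

Lemma continuous_flip : continuous (fun z : R * R => (z.1, 1 - z.2)).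
Proof.
apply: continuous_pair => z; first exact: continuous_fst.
by apply: cvgB; [exact: cvg_cst|exact: continuous_snd].
Qed.

Lemma continuous_gflip : continuous (fun z : R * R => g (z.1, 1 - z.2)).
Proof. by move=> z; apply: (continuous_comp (continuous_flip (x := z))); exact: cg. Qed.

(** Slice by slice, [p = 1 - y] turns y < 1 - x into x < p; each one-dimensional substitution goes
    through a primitive of the slice. *)
Lemma triangle_int1 : \int[leb2 R]_(z in @triangle R) g z =
  int01 (fun x => int01 (fun p => if x < p then g (x, 1 - p) else 0)).
Proof.
have -> : @triangle R = square `&` @triangle R.
  by rewrite setIC; apply/esym/setIidPl; exact: triangle_square.
rewrite Rintegral_mkcondr.
rewrite (_ : Rintegral _ _ _ = \int[leb2 R]_(z in square) gC z.1 z.2); last first.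
  by apply: eq_Rintegral => -[x y] _.
rewrite (int01_square mgC).
have mh : bmeas2 (fun x p => g (x, 1 - p)).
  by apply: continuous_bmeas2; exact: continuous_gflip.
(* The slice [x = 0] misses the open triangle, so there [gC] is zero while the right-hand integrand
   need not be. *)
apply: (@eq_int01_except 0); [exact: bmeas_int01|exact: bmeas_int01 (bmeas2_if_lt mh (bmeas2_fst (bmeas_cst 0)))|].
move=> x x01 x0.
have cgx : {within `[0, 1], continuous (fun y => g (x, y))}.
  exact/continuous_subspaceT/continuous_line2.
have [G CG] := C1on_primitive cgx.
have := int01_above x01 (C1onZ (-1) (C1on_flip CG)).
rewrite (_ : int01 _ = int01 (fun p => if x < p then g (x, 1 - p) else 0)); last first.
  apply: eq_int01 => p _; case: ifPn => // _; rewrite mulrA mulrNN !mul1r.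
  by congr (g (_, _)); ring.
move=> ->; have x1 := flip01 x01.
have := int01_split x1 CG (C1on_cst 0).
rewrite subrr addr0 mulr1 addNr => E.
rewrite (_ : _ - _ = G (-1 * x + 1) - G 0); last by ring.
rewrite -E; apply: (@eq_int01_except 0).
- exact: bmeas2_slice.
- exact: bmeas_if_lt (bmeasC1' CG) (bmeas_cst 0).
- move=> y; rewrite in_itv/= => /andP[y0 y1] yn0; rewrite /gC patchE.
  move: x01; rewrite in_itv/= => /andP[x0' _].
  have {}x0 : 0 < x by rewrite lt_neqAle eq_sym x0.
  have {}y0 : 0 < y by rewrite lt_neqAle eq_sym yn0.
  case: ifPn; rewrite ?inE /triangle/= => T.
    by case: T => _ _ xy; rewrite ifT//; lra.
  rewrite ifF//; apply/negP => yx; move/negP : T; apply; rewrite inE.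
  by split=> //=; lra.
Qed.

Lemma triangle_int2 : \int[leb2 R]_(z in @triangle R) g z =
  int01 (fun x => int01 (fun p => if p < x then g (p, 1 - x) else 0)).
Proof.
rewrite triangle_int1 [LHS]int01_swap//; apply: bmeas2_if_lt.
  by apply: continuous_bmeas2; exact: continuous_gflip.
exact: bmeas2_fst (bmeas_cst 0).
Qed.

End Triangle.

(** * Inequalities for continuously differentiable functions *)

Section PlaneInequality.
Context {R : realType}.
Implicit Types (phi phix phiy psi psix psiy g : R * R -> R).

(** The partial derivatives are explicit arguments, so that sums and concrete examples are treated
    without computing [dx] and [dy]. *)
Definition C1plane phi phix phiy : Prop :=
  [/\ continuous phi, continuous phix, continuous phiy,
      forall x y : R, is_derive x 1 (fun s => phi (s, y)) (phix (x, y)) &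
      forall x y : R, is_derive y 1 (fun t => phi (x, t)) (phiy (x, y))].

Lemma is_derive_direction phi (d : R * R) (x y : R) : derivable phi (x, y) d ->
  is_derive (0 : R) 1 (fun s => phi (s *: d + (x, y))) ('D_d phi (x, y)).
Proof.
have E : (fun h : R => h^-1 *: ((fun s : R => phi (s *: d + (x, y))) (h *: 1 + 0) -
    (fun s : R => phi (s *: d + (x, y))) 0)) =
    (fun h : R => h^-1 *: (phi (h *: d + (x, y)) - phi (x, y))).
  by apply/funext => h; rewrite addr0 scale0r add0r /GRing.scale/= mulr1.
by move=> dphi; split; rewrite /derivable /derive E.
Qed.

Lemma is_C1_C1plane phi : is_Ck 1 phi -> C1plane phi (dx phi) (dy phi).
Proof.
move=> [cphi [dphi1 dphi2 [cx _] [cy _]]].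
split; [exact: cphi|exact: cx|exact: cy|move=> x y|move=> x y].
  have E : (fun s : R => phi (s, y)) =
      (fun s : R => phi (s *: (1, 0) + (x, y))) \o (fun s => s - x).
    apply/funext => s /=; congr phi; congr pair.
      by change (s = (s - x) * 1 + x); ring.
    by change (y = (s - x) * 0 + y); ring.
  have h := @is_derive1_comp R (fun s : R => phi (s *: (1, 0) + (x, y)))
    (fun s => s - x) x (dx phi (x, y)) 1.
  rewrite E -[dx phi (x, y)]mulr1; apply: h.
    by rewrite subrr; exact: is_derive_direction.
  by apply: trigger_derive; rewrite /GRing.scale /=; ring.
have E : (fun t : R => phi (x, t)) =
    (fun s : R => phi (s *: (0, 1) + (x, y))) \o (fun s => s - y).
  apply/funext => s /=; congr phi; congr pair.
    by change (x = (s - y) * 0 + x); ring.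
  by change (s = (s - y) * 1 + y); ring.
have h := @is_derive1_comp R (fun s : R => phi (s *: (0, 1) + (x, y)))
  (fun s => s - y) y (dy phi (x, y)) 1.
rewrite E -[dy phi (x, y)]mulr1; apply: h.
  by rewrite subrr; exact: is_derive_direction.
by apply: trigger_derive; rewrite /GRing.scale /=; ring.
Qed.

Lemma C1planeB phi phix phiy psi psix psiy :
  C1plane phi phix phiy -> C1plane psi psix psiy ->
  C1plane (fun z => phi z - psi z) (fun z => phix z - psix z)
    (fun z => phiy z - psiy z).
Proof.
move=> [c cx cy d1 d2] [c' cx' cy' d1' d2']; split.
- by move=> z; exact: cvgB (c z) (c' z).
- by move=> z; exact: cvgB (cx z) (cx' z).
- by move=> z; exact: cvgB (cy z) (cy' z).
- by move=> x y; exact: is_deriveB.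
- by move=> x y; exact: is_deriveB.
Qed.

Lemma C1plane_affine (b c : R) :
  C1plane (fun z => b * z.1 + c * z.2) (fun=> b) (fun=> c).
Proof.
split; [|exact: cst_continuous|exact: cst_continuous|..].
- move=> z; apply: cvgD; apply: cvgM; [exact: cvg_cst|exact: continuous_fst|
    exact: cvg_cst|exact: continuous_snd].
- move=> x y; change (is_derive x 1 (fun s : R => b * s + c * y) b).
  by apply: trigger_derive; rewrite /GRing.scale /=; ring.
- move=> x y; change (is_derive y 1 (fun t : R => b * x + c * t) c).
  by apply: trigger_derive; rewrite /GRing.scale /=; ring.
Qed.

(** Each half of the square is a copy of the triangle, and the diagonal meets every slice in a
    single point. *)
Lemma triangle_split g1 g2 (G : R -> R -> R) : continuous g1 -> continuous g2 ->
  bmeas2 G -> (forall x p, x != p -> G x p = if x < p then g1 (x, 1 - p) else g2 (p, 1 - x)) ->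
  int01 (fun x => int01 (G x)) =
  \int[leb2 R]_(z in @triangle R) g1 z + \int[leb2 R]_(z in @triangle R) g2 z.
Proof.
move=> c1 c2 mG GE; rewrite (triangle_int1 c1) (triangle_int2 c2).
have m0 : bmeas2 (fun _ _ => 0 : R) := bmeas2_fst (bmeas_cst 0).
have m1 := bmeas2_if_lt
  (continuous_bmeas2 (F := fun x p => g1 (x, 1 - p)) (continuous_gflip c1)) m0.
have m2 := bmeas2_swap (bmeas2_if_lt
  (continuous_bmeas2 (F := fun x p => g2 (x, 1 - p)) (continuous_gflip c2)) m0).
rewrite -int01D; [|exact: bmeas_int01 m1|exact: bmeas_int01 m2].
apply: eq_int01 => x x01.
have m1x := bmeas2_slice x01 m1; have m2x := bmeas2_slice x01 m2.
rewrite -int01D; [|bmeas_tac..].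
apply: (@eq_int01_except _ x); [exact: bmeas2_slice|bmeas_tac|].
move=> p _ px; rewrite GE; last by rewrite eq_sym.
by move: px; case: ltgtP => // _ _; rewrite ?addr0 ?add0r.
Qed.

Variables (phi phix phiy : R * R -> R).
Hypothesis Cphi : C1plane phi phix phiy.

Let N := \int[leb2 R]_(z in @triangle R) (phi z ^+ 2).
Let G := \int[leb2 R]_(z in @triangle R) (phix z ^+ 2 + phiy z ^+ 2).
Let m1 := int01 (fun t => phi (t, 0)).
Let m2 := int01 (fun t => phi (0, t)).

Lemma C1plane_kernel : exists A a, [/\ wder A a, A 0 = m2, A 1 = m1,
  0 <= 2 * N - 2 * int01 (fun x => A x ^+ 2) + int01 A ^+ 2 &
  int01 (fun x => a x ^+ 2) +
    9 * (2 * N - 2 * int01 (fun x => A x ^+ 2) + int01 A ^+ 2) <= G].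
Proof.
have [cp cx cy dpx dpy] := Cphi.
pose h x p := phi (x, 1 - p); pose h1 x p := phix (x, 1 - p).
pose h2 x p := - phiy (x, 1 - p).
have ch : continuous (fun z : R * R => h z.1 z.2) by exact: continuous_gflip.
have ch1 : continuous (fun z : R * R => h1 z.1 z.2) by exact: continuous_gflip.
have ch2 : continuous (fun z : R * R => h2 z.1 z.2).
  by move=> z; apply: continuousN; exact: continuous_gflip.
have dh1 (x y : R) : is_derive x 1 (h ^~ y) (h1 x y) by exact: dpx.
have dh2 (x y : R) : is_derive y 1 (h x) (h2 x y).
  have dl : is_derive y 1 (fun s : R => 1 - s) (-1).
    by apply: trigger_derive; rewrite /GRing.scale /=; ring.
  have := @is_derive1_comp R (fun t => phi (x, t)) (fun s => 1 - s) y _ _ (dpy x (1 - y)) dl.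
  by rewrite mulrN1.
have [A [a [U [W [[wA A0 A1 [mU UE] [mW WE]] [var en]]]]]] :=
  kernel_inequality ch ch1 ch2 dh1 dh2.
have SU : int01 (fun x => int01 (fun p => U x p ^+ 2)) = 2 * N.
  rewrite (triangle_split (continuous_sqr cp) (continuous_sqr cp) (bmeas2X 2 mU)).
    exact: esym (mulr_natl N 2).
  by move=> x p xp; rewrite UE//; case: ifP.
have SW : int01 (fun x => int01 (fun p => W x p ^+ 2)) = G.
  rewrite (triangle_split (continuous_sqr cx) (continuous_sqr cy) (bmeas2X 2 mW)); last first.
    by move=> x p xp; rewrite WE//; case: ifP => // _; rewrite /h2 sqrrN.
  rewrite /G RintegralD//; first exact: measurable_triangle.
    by apply: integrable_triangle; exact: continuous_sqr.
  by apply: integrable_triangle; exact: continuous_sqr.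
rewrite SU SW in var en; exists A, a; split => //.
- rewrite A0 /m2 -(@int01_reflect _ (fun t => phi (0, t)))//.
  exact/continuous_subspaceT/continuous_line2.
- by rewrite A1; apply: eq_int01 => x _; rewrite /h subrr.
Qed.

(** Testing the derivative of [A] against x and x - 1 isolates [A 1] and [A 0]: each is [int01 A]
    plus an integral of [a] with a weight bounded by 1. Moreover int A^2 <= 2 N, by the variance
    bound and c^2 <= int A^2, and int a^2 <= G. *)
Lemma leg_mean_sqr_le : m1 ^+ 2 <= 4 * (N + G) /\ m2 ^+ 2 <= 4 * (N + G).
Proof.
have [A [a [wA A0 A1 var en]]] := C1plane_kernel.
have mA := wder_bmeas wA; case: wA => _ ma IA.
have G0 : 0 <= G by apply: Rintegral_ge0 => z _; rewrite addr_ge0 ?sqr_ge0.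
have N0 : 0 <= N by apply: Rintegral_ge0 => z _; exact: sqr_ge0.
have h1 := sqr_int01_le mA.
have Cw := @C1on_id R.
have Cv : C1on (fun x : R => x - 1) (fun=> 1).
  by have := C1onD Cw (C1on_cst (-1)); apply: eq_C1on => x _; rewrite addr0.
have bound (w : R -> R) : bmeas w -> (forall x, x \in `[0, 1] -> w x ^+ 2 <= 1) ->
    int01 (fun x => a x * w x) ^+ 2 <= int01 (fun x => a x ^+ 2).
  move=> mw w1; apply: le_trans (sqr_int01_le (bmeasM ma mw)) _.
  apply: ler_int01; [bmeas_tac|bmeas_tac|] => x x01.
  by rewrite exprMn ler_piMr ?sqr_ge0// w1.
have [mw mv] := (bmeasC1 Cw, bmeasC1 Cv).
have b1 : int01 (fun x => a x * x) ^+ 2 <= int01 (fun x => a x ^+ 2).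
  by apply: bound => // x; rewrite in_itv/= => /andP[? ?]; nra.
have b2 : int01 (fun x => a x * (x - 1)) ^+ 2 <= int01 (fun x => a x ^+ 2).
  by apply: bound => // x; rewrite in_itv/= => /andP[? ?]; nra.
have E1 := IA _ _ Cw; have E2 := IA _ _ Cv.
rewrite mulr1 mulr0 subr0 A1 in E1; rewrite subrr mulr0 !sub0r mulrN1 opprK A0 in E2.
have EA : int01 (fun x => A x * 1) = int01 A by apply: eq_int01 => x _; rewrite mulr1.
rewrite EA in E1 E2.
have sq (u v w S T : R) : u = w + v -> w ^+ 2 <= S -> v ^+ 2 <= T -> u ^+ 2 <= 2 * S + 2 * T.
  by move=> -> ? ?; have := sqr_ge0 (w - v); nra.
split.
  apply: (@le_trans _ _ (2 * int01 (fun x => A x ^+ 2) + 2 * int01 (fun x => a x ^+ 2))).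
    apply: (sq _ (int01 (fun x => a x * x)) (int01 A)) => //; lra.
  lra.
apply: (@le_trans _ _ (2 * int01 (fun x => A x ^+ 2) + 2 * int01 (fun x => a x ^+ 2))).
  apply: (sq _ (int01 (fun x => a x * (x - 1))) (int01 A)) => //; lra.
lra.
Qed.

Variable k : R.
Hypotheses (k_bounds : 2 < k < 21 / 10) (k_root : k * cos k + sin k = 0).

(** With D the variance term, l N = (l / 2) D + l (int A^2 - c^2 / 2). The hypothesis bounds the
    second part by int a^2, and 9 D bounds the first since l <= 18. *)
Let poincare_of (l : R) : 0 <= l <= 18 -> (forall A a, wder A a ->
    A 0 = m2 -> A 1 = m1 ->
    l * (int01 (fun x => A x ^+ 2) - int01 A ^+ 2 / 2) <= int01 (fun x => a x ^+ 2)) ->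
  l * N <= G.
Proof.
move=> /andP[l0 l1] pc; have [A [a [wA A0 A1 var en]]] := C1plane_kernel.
have {}pc := pc _ _ wA A0 A1.
set D := 2 * N - _ + _ in var en.
have : 0 <= (9 - l / 2) * D by apply: mulr_ge0 => //; lra.
by rewrite /D in en *; lra.
Qed.

Lemma C1plane_poincare1 : m1 = 0 -> k ^+ 2 * N <= G.
Proof.
move=> m10; have /andP[? ?] := k_bounds; apply: poincare_of.
  by apply/andP; split; nra.
by move=> A a wA _ A1; apply: poincare_right => //; rewrite A1.
Qed.

Lemma C1plane_poincare2 : m2 = 0 -> k ^+ 2 * N <= G.
Proof.
move=> m20; have /andP[? ?] := k_bounds; apply: poincare_of.
  by apply/andP; split; nra.
by move=> A a wA A0 _; apply: poincare_left => //; rewrite A0.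
Qed.

Lemma C1plane_poincare12 : m1 = 0 -> m2 = 0 -> 4 * k ^+ 2 * N <= G.
Proof.
move=> m10 m20; have /andP[? ?] := k_bounds; apply: poincare_of.
  by apply/andP; split; nra.
by move=> A a wA A0 A1; apply: poincare_both => //; rewrite ?A0 ?A1.
Qed.

End PlaneInequality.

(** * From smooth functions to H^1 *)

Section L2norm.
Context d (X : measurableType d) (R : realType) (mu : {measure set X -> \bar R}).
Variables (D : set X) (mD : measurable D).
Implicit Types (f g : X -> R).

Lemma L2normE f : L2norm mu D f = ((\int[mu]_(x in D) (f x ^+ 2)%:E) `^ 2^-1)%E.
Proof.
rewrite /L2norm unlock; congr (_ `^ _)%E; rewrite [RHS]integral_mkcond.
apply: eq_integral => x _ /=; rewrite !patchE; case: ifPn => _.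
  by rewrite powR_mulrn// real_normK// num_real.
by rewrite [`|_|]normr0 powR0.
Qed.

Lemma L2norm_ge0 f : (0 <= L2norm mu D f)%E.
Proof. exact: Lnorm_ge0. Qed.

Lemma ler_L2norm f g : measurable_fun D f -> measurable_fun D g ->
  (forall x, D x -> `|f x| <= `|g x|) -> (L2norm mu D f <= L2norm mu D g)%E.
Proof.
move=> mf mg fg; rewrite !L2normE; apply: gt0_ler_poweR => //.
- by rewrite in_itv/= leey andbT integral_ge0// => x _; rewrite lee_fin sqr_ge0.
- by rewrite in_itv/= leey andbT integral_ge0// => x _; rewrite lee_fin sqr_ge0.
apply: ge0_le_integral => //.
- by move=> x _; rewrite lee_fin sqr_ge0.
- by apply/measurable_EFinP; exact: measurable_funX.
- by apply/measurable_EFinP; exact: measurable_funX.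
- by move=> x Dx; rewrite lee_fin -(real_normK (num_real (f x))) -(real_normK (num_real (g x))) lerXn2r ?nnegrE ?fg.
Qed.

Lemma L2normD f g : measurable_fun D f -> measurable_fun D g ->
  (L2norm mu D (fun x => f x + g x)%R <= L2norm mu D f + L2norm mu D g)%E.
Proof.
move=> mf mg; rewrite /L2norm (_ : (fun x => _) \_ D = (f \_ D) \+ (g \_ D)).
  by apply: minkowski_EFin => //; [exact/(measurable_restrictT _ mD)..|rewrite ler1n].
by apply/funext => x; rewrite /= !patchE; case: ifP; rewrite ?addr0.
Qed.

Lemma L2norm_fin f : mu.-integrable D (EFin \o (fun x => f x ^+ 2)) ->
  L2norm mu D f = (Num.sqrt (\int[mu]_(x in D) (f x ^+ 2)))%:E.
Proof.
move=> If; rewrite L2normE -[X in (X `^ _)%E](fineK (integrable_fin_num mD If)).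
rewrite poweR_EFin powR12_sqrt//; apply: fine_ge0.
by apply: integral_ge0 => x _; rewrite lee_fin sqr_ge0.
Qed.

Lemma L2norm_le_cst f (M : R) : (mu D <= 1)%E -> measurable_fun D f ->
  (forall x, D x -> `|f x| <= M) -> 0 <= M -> (L2norm mu D f <= M%:E)%E.
Proof.
move=> D1 mf fM M0.
have Dfin : mu D \is a fin_num.
  by rewrite ge0_fin_numE// (le_lt_trans D1)// ltry.
apply: (@le_trans _ _ (L2norm mu D (fun=> M))).
  by apply: ler_L2norm => // x Dx; rewrite (ger0_norm M0) fM.
rewrite L2normE integral_cst// -(fineK Dfin) -EFinM poweR_EFin lee_fin.
rewrite powR12_sqrt; last by rewrite mulr_ge0 ?sqr_ge0// fine_ge0.
rewrite -[leRHS](ger0_norm M0) -sqrtr_sqr ler_wsqrtr// ler_piMr ?sqr_ge0//.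
by rewrite -lee_fin fineK.
Qed.

(** Hoelder's inequality against the constant 1, whose norm is at most 1 because [mu D] is. *)
Lemma integral_abs_le_L2norm f : (mu D <= 1)%E -> measurable_fun D f ->
  (\int[mu]_(x in D) `|f x|%:E <= L2norm mu D f)%E.
Proof.
move=> D1 mf.
pose u : X -> R := fun=> 1.
have m1 : measurable_fun [set: X] (u \_ D) by apply/(measurable_restrictT _ mD); exact: measurable_cst.
have mf' : measurable_fun [set: X] (f \_ D) by exact/(measurable_restrictT _ mD).
have := @hoelder _ _ _ mu _ _ 2 2 mf' m1 (ltr0Sn _ _) (ltr0Sn _ _).
have -> : (2^-1 + 2^-1 = 1 :> R)%R by field.
move=> /(_ erefl) h.
have E : (\int[mu]_(x in D) `|f x|%:E <= \int[mu]_x `|(f \_ D) x * (u \_ D) x|%:E)%E.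
  rewrite integral_mkcond le_eqVlt; apply/orP; left; apply/eqP.
  apply: eq_integral => x _ /=; rewrite !patchE; case: ifP => _.
    by rewrite mulr1.
  by rewrite mulr0 normr0.
rewrite Lnorm1 in h; apply: (le_trans E); apply: (le_trans h); rewrite -[leRHS]mule1 lee_wpmul2l//.
  exact: L2norm_ge0.
have := @L2norm_le_cst u 1 D1 (measurable_cst _) _ ler01; apply => x _.
by rewrite normr1.
Qed.

End L2norm.

(** * The inequality in L_2 norms, with a defect for nonzero leg means *)

Section SobolevInequality.
Context {R : realType}.
Implicit Types (phi phix phiy f g : R * R -> R) (v : H1 R).

Let LT f := L2norm (leb2 R) (@triangle R) f.
Let mT := @measurable_triangle R.
Local Notation mfun := (measurable_fun (@triangle R : set (measurableTypeR R * measurableTypeR R))).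

Definition grad_norm f g : R * R -> R := fun z => Num.sqrt (f z ^+ 2 + g z ^+ 2).

Lemma measurable_grad_norm f g : mfun f -> mfun g -> mfun (grad_norm f g).
Proof.
move=> mf mg; apply: (@measurableT_comp _ _ _ _ _ _ (@Num.sqrt R)).
  by apply: continuous_measurable_fun; exact: sqrt_continuous.
by apply: measurable_funD; exact: measurable_funX.
Qed.

(** The main gradient keeps the factor 1, so that sharp constants survive the limit; the
    perturbation only has to tend to zero and is estimated coordinate by coordinate. *)
Lemma L2norm_gradD f g f' g' : mfun f -> mfun g -> mfun f' -> mfun g' ->
  (LT (grad_norm (fun z => (f z + f' z)%R) (fun z => (g z + g' z)%R)) <=
   LT (grad_norm f g) + (LT f' + LT g'))%E.
Proof.
move=> mf mg mf' mg'.
have mn := measurable_grad_norm mf mg.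
have ma : mfun (fun z => `|f' z|) by exact: measurableT_comp.
have mb : mfun (fun z => `|g' z|) by exact: measurableT_comp.
apply: (@le_trans _ _ (LT (fun z => grad_norm f g z + (`|f' z| + `|g' z|))%R)).
  apply: ler_L2norm => //.
  - by apply: measurable_grad_norm; exact: measurable_funD.
  - by apply: measurable_funD => //; exact: measurable_funD.
  move=> z _; rewrite [leLHS]ger0_norm; last exact: sqrtr_ge0.
  rewrite [leRHS]ger0_norm; last by rewrite addr_ge0 ?addr_ge0 ?sqrtr_ge0.
  have := sqr_sqrtr (addr_ge0 (sqr_ge0 (f z)) (sqr_ge0 (g z))).
  rewrite -/(grad_norm f g z); set s := grad_norm f g z => sE.
  have s0 : 0 <= s by exact: sqrtr_ge0.
  have fs : `|f z| <= s.
    by rewrite /s /grad_norm -sqrtr_sqr ler_wsqrtr// lerDl sqr_ge0.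
  have gs : `|g z| <= s.
    by rewrite /s /grad_norm -sqrtr_sqr ler_wsqrtr// lerDr sqr_ge0.
  rewrite -(@ler_pXn2r _ 2) ?nnegrE ?sqrtr_ge0 ?addr_ge0//.
  rewrite sqr_sqrtr ?addr_ge0 ?sqr_ge0//.
  have ff : f z * f' z <= s * `|f' z|.
    by rewrite (le_trans (ler_norm _))// normrM ler_wpM2r.
  have gg : g z * g' z <= s * `|g' z|.
    by rewrite (le_trans (ler_norm _))// normrM ler_wpM2r.
  have f2 := real_normK (num_real (f' z)); have g2 := real_normK (num_real (g' z)).
  have fg : 0 <= `|f' z| * `|g' z| by exact: mulr_ge0.
  rewrite !sqrrD !mulr2n; lra.
apply: (le_trans (L2normD _ mT mn (measurable_funD ma mb))).
apply: leeD2l; apply: (le_trans (L2normD _ mT ma mb)).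
by apply: leeD; apply: ler_L2norm => // z _; rewrite normr_id.
Qed.

Lemma continuous_mfun f : continuous f -> mfun f.
Proof. by move=> cf; apply: measurable_funTS; exact: continuous2_measurable. Qed.

Lemma L2norm_triangle f : continuous f ->
  LT f = (Num.sqrt (\int[leb2 R]_(z in @triangle R) (f z ^+ 2)))%:E.
Proof. by move=> cf; apply: L2norm_fin => //; apply: integrable_triangle; exact: continuous_sqr. Qed.

Lemma L2norm_grad_triangle f g : continuous f -> continuous g ->
  LT (grad_norm f g) = (Num.sqrt (\int[leb2 R]_(z in @triangle R) (f z ^+ 2 + g z ^+ 2)))%:E.
Proof.
move=> cf cg; have E z : grad_norm f g z ^+ 2 = f z ^+ 2 + g z ^+ 2.
  by rewrite sqr_sqrtr// addr_ge0 ?sqr_ge0.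
rewrite /LT L2norm_fin//.
  by congr (Num.sqrt _)%:E; apply: eq_Rintegral => z _; exact: E.
rewrite (_ : (fun z => _) = (fun z => f z ^+ 2 + g z ^+ 2)); last by apply/funext.
by apply: integrable_triangle => z; apply: cvgD; exact: continuous_sqr.
Qed.

Definition leg_mean1 phi := int01 (fun t => phi (t, 0)).
Definition leg_mean2 phi := int01 (fun t => phi (0, t)).

Lemma leg_mean_le phi phix phiy : C1plane phi phix phiy ->
  (`|leg_mean1 phi|%:E <= 2%:E * (LT phi + (LT phix + LT phiy)))%E /\
  (`|leg_mean2 phi|%:E <= 2%:E * (LT phi + (LT phix + LT phiy)))%E.
Proof.
move=> C; have [c cx cy _ _] := C; have [b1 b2] := leg_mean_sqr_le C.
rewrite !L2norm_triangle//; move: b1 b2; rewrite RintegralD//; last 2 first.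
  by apply: integrable_triangle; exact: continuous_sqr.
  by apply: integrable_triangle; exact: continuous_sqr.
set n := Rintegral _ _ _; set nx := Rintegral _ _ _; set ny := Rintegral _ _ _.
have n0 : 0 <= n by apply: Rintegral_ge0 => z _; exact: sqr_ge0.
have nx0 : 0 <= nx by apply: Rintegral_ge0 => z _; exact: sqr_ge0.
have ny0 : 0 <= ny by apply: Rintegral_ge0 => z _; exact: sqr_ge0.
have bound (m : R) : m ^+ 2 <= 4 * (n + (nx + ny)) ->
    `|m| <= 2 * (Num.sqrt n + (Num.sqrt nx + Num.sqrt ny)).
  move=> h; rewrite -(@ler_pXn2r _ 2) ?nnegrE ?mulr_ge0 ?addr_ge0 ?sqrtr_ge0//.
  rewrite real_normK ?num_real// (le_trans h)//.
  rewrite -{1}(sqr_sqrtr n0) -{1}(sqr_sqrtr nx0) -{1}(sqr_sqrtr ny0).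
  have := sqrtr_ge0 n; have := sqrtr_ge0 nx; have := sqrtr_ge0 ny.
  move: (Num.sqrt n) (Num.sqrt nx) (Num.sqrt ny) => p q r p0 q0 r0.
  have := mulr_ge0 p0 q0; have := mulr_ge0 q0 r0; have := mulr_ge0 p0 r0.
  by rewrite exprMn !sqrrD; lra.
by move=> /bound b1 /bound b2; rewrite -!EFinD -EFinM !lee_fin.
Qed.

(** The booleans tell on which legs the mean is prescribed, so that one argument serves all three
    constants. *)
Variables (s1 s2 : bool) (K : R).
Hypothesis K0 : 0 < K.
Hypothesis poincareK : forall phi phix phiy, C1plane phi phix phiy ->
  (s1 -> leg_mean1 phi = 0) -> (s2 -> leg_mean2 phi = 0) ->
  \int[leb2 R]_(z in @triangle R) (phi z ^+ 2) <=
  K ^+ 2 * \int[leb2 R]_(z in @triangle R) (phix z ^+ 2 + phiy z ^+ 2).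

(** The factor 2 offsets the mean 1 / 2 of a coordinate over its leg. Each coordinate vanishes on
    the other leg, so the two corrections do not interact. *)
Let b1 phi := if s1 then 2 * leg_mean1 phi else 0.
Let b2 phi := if s2 then 2 * leg_mean2 phi else 0.

(* Subtracting [b1 x + b2 y] makes the prescribed leg means vanish. *)
Lemma C1plane_poincare_defect phi phix phiy : C1plane phi phix phiy ->
  (LT phi <= K%:E * LT (grad_norm phix phiy) +
    ((K + 1) * (`|b1 phi| + `|b2 phi|))%:E)%E.
Proof.
move=> C; set b := b1 phi; set c := b2 phi.
have [cp cx cy _ _] := C; have Ca := C1plane_affine b c.
have Cq := C1planeB C Ca; have [cq cqx cqy _ _] := Cq; have [ca _ _ _ _] := Ca.
have half : int01 (fun t : R => t) = 1 / 2.
  have Cw := @C1on_id R.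
  have := int01_FTC (C1onM Cw Cw).
  rewrite (_ : int01 _ = 2 * int01 (fun t : R => t)).
    by rewrite mulr1 mulr0 subr0 => h; apply: (mulfI (_ : 2 != 0 :> R)) => //; rewrite h; field.
  rewrite -int01Zl; last exact: bmeasC1 Cw.
  by apply: eq_int01 => x _; ring.
have mid : bmeas (fun t : R => t) by apply: continuous_bmeas => x; exact: cvg_id.
have mslice1 := continuous_bmeas (continuous_line1 (y := 0) cp).
have mslice2 := continuous_bmeas (continuous_line2 (x := 0) cp).
have q1 : s1 -> leg_mean1 (fun z => phi z - (b * z.1 + c * z.2)) = 0.
  move=> s1T; rewrite /leg_mean1.
  transitivity (int01 (fun t => phi (t, 0) - b * t)).
    by apply: eq_int01 => t _ /=; rewrite mulr0 addr0.
  by rewrite int01B ?int01Zl ?half -/(leg_mean1 phi); [rewrite /b /b1 s1T; field|bmeas_tac..].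
have q2 : s2 -> leg_mean2 (fun z => phi z - (b * z.1 + c * z.2)) = 0.
  move=> s2T; rewrite /leg_mean2.
  transitivity (int01 (fun t => phi (0, t) - c * t)).
    by apply: eq_int01 => t _ /=; rewrite mulr0 add0r.
  by rewrite int01B ?int01Zl ?half -/(leg_mean2 phi); [rewrite /c /b2 s2T; field|bmeas_tac..].
have := poincareK Cq q1 q2; set q := (fun z => phi z - _) in cq *.
move=> NG.
have e1 : (LT q <= K%:E * LT (grad_norm (fun z => (phix z - b)%R) (fun z => (phiy z - c)%R)))%E.
  rewrite L2norm_triangle// L2norm_grad_triangle// -EFinM lee_fin.
  rewrite -[K in leRHS](ger0_norm (ltW K0)) -sqrtr_sqr -sqrtrM ?sqr_ge0//.
  exact: ler_wsqrtr.
have D1 := @leb2_triangle_le1 R.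
have mcst (r : R) : mfun (fun=> r) by exact: measurable_cst.
have e2 : (LT (fun z => (b * z.1 + c * z.2)%R) <= (`|b| + `|c|)%:E)%E.
  apply: L2norm_le_cst => //; [exact: continuous_mfun|move=> [x y]].
  move=> [/= x0 y0 xy]; rewrite (le_trans (ler_normD _ _))// lerD// normrM.
    by rewrite ler_piMr// gtr0_norm//; lra.
  by rewrite ler_piMr// gtr0_norm//; lra.
have e3 : (LT (grad_norm (fun z => (phix z - b)%R) (fun z => (phiy z - c)%R)) <=
    LT (grad_norm phix phiy) + (`|b| + `|c|)%:E)%E.
  have [mx my] := (continuous_mfun cx, continuous_mfun cy).
  apply: (le_trans (L2norm_gradD mx my (mcst (- b)) (mcst (- c)))).
  apply: leeD2l; rewrite EFinD; apply: leeD; apply: L2norm_le_cst => // z _.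
    by rewrite normrN.
  by rewrite normrN.
have e4 : (LT phi <= LT q + LT (fun z => (b * z.1 + c * z.2)%R))%E.
  rewrite {1}(_ : phi = (fun z => q z + (b * z.1 + c * z.2))).
    by apply: L2normD => //; exact: continuous_mfun.
  by apply/funext => z; rewrite /q subrK.
apply: (le_trans e4).
(* The affine correction costs [|b| + |c|] in the function and again, multiplied by K, in the
   gradient; hence K + 1. *)
apply: (@le_trans _ _ (K%:E * (LT (grad_norm phix phiy) + (`|b| + `|c|)%:E) +
  (`|b| + `|c|)%:E)%E).
  apply: leeD => //; apply: (le_trans e1); apply: lee_wpmul2l => //.
  by rewrite lee_fin ltW.
rewrite L2norm_grad_triangle// -!EFinD lee_fin.
by rewrite le_eqVlt; apply/orP; left; apply/eqP; ring.
Qed.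

End SobolevInequality.

(** * Passage to the limit in H^1(T) *)

Section Limit.
Context {R : realType}.
Implicit Types (phi psi : nat -> R * R -> R) (v : H1 R) (e : R -> R * R).

Let LT (f : R * R -> R) := L2norm (leb2 R) (@triangle R) f.
Let mT := @measurable_triangle R.
Local Notation mfun := (measurable_fun (@triangle R : set (measurableTypeR R * measurableTypeR R))).

Lemma cvge0D (f g : nat -> \bar R) : f @ \oo --> 0%E -> g @ \oo --> 0%E ->
  (fun n => f n + g n)%E @ \oo --> 0%E.
Proof. by move=> f0 g0; rewrite -[X in _ --> X]adde0; exact: cvgeD. Qed.

Lemma cvge0Z (r : R) (f : nat -> \bar R) : f @ \oo --> 0%E ->
  (fun n => r%:E * f n)%E @ \oo --> 0%E.
Proof. by move=> f0; rewrite -[X in _ --> X](mule0 r%:E); exact: cvgeZl. Qed.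

Lemma L2normN d (X : measurableType d) (mu : {measure set X -> \bar R}) (D : set X)
  (f : X -> R) : L2norm mu D (fun x => - f x) = L2norm mu D f.
Proof.
rewrite /L2norm -[RHS]oppe_Lnorm; congr Lnorm; apply/funext => x /=.
by rewrite !patchE; case: ifP => _ //=; rewrite oppr0.
Qed.

Let LTN f : LT (fun p => - f p) = LT f. Proof. exact: L2normN. Qed.

Lemma H1_converges_diff phi psi v n : is_Ck 1 (phi n) -> is_Ck 1 (psi n) ->
  forall (w := LT (fun p => psi n p - phi n p))
    (wx := LT (fun p => dx (psi n) p - dx (phi n) p))
    (wy := LT (fun p => dy (psi n) p - dy (phi n) p)),
  [/\ (w <= LT (fun p => (psi n p - v p)%R) + LT (fun p => (phi n p - v p)%R))%E,
      (wx <= LT (fun p => (dx (psi n) p - H1dx v p)%R) +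
             LT (fun p => (dx (phi n) p - H1dx v p)%R))%E &
      (wy <= LT (fun p => (dy (psi n) p - H1dy v p)%R) +
             LT (fun p => (dy (phi n) p - H1dy v p)%R))%E].
Proof.
move=> /is_C1_C1plane[cf cfx cfy _ _] /is_C1_C1plane[cg cgx cgy _ _] w wx wy.
have D (f g h : R * R -> R) : mfun f -> mfun g -> mfun h ->
    (LT (fun p => (f p - g p)%R) <= LT (fun p => (f p - h p)%R) + LT (fun p => (g p - h p)%R))%E.
  move=> mf mg mh; rewrite -(LTN (fun p => g p - h p)).
  rewrite {1}(_ : (fun p => f p - g p) = (fun p => (f p - h p) + - (g p - h p))).
    apply: L2normD => //; first exact: measurable_funB.
    by apply: measurableT_comp => //; exact: measurable_funB.
  by apply/funext => p; ring.
split; apply: D; try exact: continuous_mfun.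
- exact: (H1fun_L2 v).1.
- exact: (H1dx_L2 v).1.
- exact: (H1dy_L2 v).1.
Qed.

Lemma trace_mean_le e (g f : R -> R) : in_L2 (leb1 R) `[0, 1] g ->
  \int[leb1 R]_(t in `[0, 1]) g t = 0 -> continuous f ->
  (`|int01 f|%:E <= L2norm (leb1 R) `[0%R, 1%R] (fun t => f t - g t)%R)%E.
Proof.
move=> [mg g2] Ig cf.
have mI : measurable (`[0, 1]%classic : set (measurableTypeR R)) by exact: measurable_itv.
have I1 : (leb1 R `[0%R, 1%R]%classic <= 1)%E by rewrite [X in (X <= _)%E]leb1_itv01.
have mf := continuous_bmeas cf.
have Ig' : (leb1 R).-integrable (`[0, 1] : set (measurableTypeR R)) (EFin \o g).
  apply/integrableP; split; first exact/measurable_EFinP.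
  exact: le_lt_trans (integral_abs_le_L2norm mI I1 mg) g2.
have If := bmeas_integrable mf.
have mh : measurable_fun (`[0, 1] : set (measurableTypeR R)) (fun t => f t - g t).
  by apply: measurable_funB => //; exact: mf.1.
apply: le_trans _ (integral_abs_le_L2norm mI I1 mh).
have -> : int01 f = \int[leb1 R]_(t in `[0, 1]) (f t - g t).
  by rewrite RintegralB// Ig subr0.
have Ih : (leb1 R).-integrable (`[0, 1] : set (measurableTypeR R))
    (EFin \o (fun t => f t - g t)).
  by apply: eq_integrable (integrableB mI If Ig') => // t _; rewrite /= EFinB.
rewrite EFin_normr_Rintegral//.
by apply: le_abse_integral => //; exact/measurable_EFinP.
Qed.

(** Each trace condition comes with its own approximating sequence, whereas the limit argument needs
    a single one. The means of the sequence from the trace tend to zero, and its difference from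
    [psi] tends to zero in H^1, which controls the leg mean. *)
Lemma leg_mean_cvg e v psi : continuous e ->
  (forall f fx fy, C1plane f fx fy ->
    (`|int01 (fun t => f (e t))|%:E <= 2%:E * (LT f + (LT fx + LT fy)))%E) ->
  V e v -> (forall n, is_Ck 1 (psi n)) -> H1_converges psi v ->
  (fun n => `|int01 (fun t => psi n (e t))|%:E) @ \oo --> 0%E.
Proof.
move=> ce bound [g [gL2 [phi [sphi [cphi cphix cphiy] tr]]] Ig] spsi [cpsi cpsix cpsiy].
have C1phi n : is_Ck 1 (phi n) by exact: sphi.
apply: (@squeeze_cvge _ _ _ _ (cst 0%E) _ (fun n =>
  L2norm (leb1 R) `[0%R, 1%R] (fun t => (phi n (e t) - g t)%R) +
  2%:E * ((LT (fun p => (psi n p - v p)%R) + LT (fun p => (phi n p - v p)%R)) +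
   ((LT (fun p => (dx (psi n) p - H1dx v p)%R) + LT (fun p => (dx (phi n) p - H1dx v p)%R)) +
    (LT (fun p => (dy (psi n) p - H1dy v p)%R) + LT (fun p => (dy (phi n) p - H1dy v p)%R)))))%E).
- apply: nearW => n; rewrite lee_fin normr_ge0/=.
  have [Cphi Cpsi] := (is_C1_C1plane (C1phi n), is_C1_C1plane (spsi n)).
  have cec (f : R * R -> R) : continuous f -> continuous (fun t => f (e t)).
    by move=> cf t; exact: (@continuous_comp _ _ _ e f t (ce t) (cf (e t))).
  have [mp mq] : bmeas (fun t => phi n (e t)) /\ bmeas (fun t => psi n (e t)).
    by split; apply/continuous_bmeas/cec; [case: Cphi|case: Cpsi].
  have -> : int01 (fun t => psi n (e t)) =
      int01 (fun t => phi n (e t)) + int01 (fun t => psi n (e t) - phi n (e t)).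
    by rewrite int01B// addrC subrK.
  apply: (@le_trans _ _ (`|int01 (fun t => phi n (e t))|%:E +
    `|int01 (fun t => psi n (e t) - phi n (e t))|%:E)%E).
    by rewrite -EFinD lee_fin ler_normD.
  apply: leeD; first by apply: trace_mean_le => //; apply: cec; case: Cphi.
  apply: (le_trans (bound _ _ _ (C1planeB Cpsi Cphi))).
  apply: lee_wpmul2l => //.
  by have [? ? ?] := H1_converges_diff v (C1phi n) (spsi n); do 2?apply: leeD.
- exact: cvg_cst.
- apply: cvge0D; first exact: tr.
  by apply: cvge0Z; apply: cvge0D; [|apply: cvge0D]; apply: cvge0D.
Qed.

Variables (s1 s2 : bool) (K : R).
Hypothesis K0 : 0 < K.
Hypothesis poincareK : forall phi phix phiy : R * R -> R, C1plane phi phix phiy ->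
  (s1 -> leg_mean1 phi = 0) -> (s2 -> leg_mean2 phi = 0) ->
  \int[leb2 R]_(z in @triangle R) (phi z ^+ 2) <=
  K ^+ 2 * \int[leb2 R]_(z in @triangle R) (phix z ^+ 2 + phiy z ^+ 2).

(** The approximating smooth functions are taken from one of the trace conditions, hence [s1 || s2].
    Their defects vanish in the limit by [leg_mean_cvg]. *)
Lemma H1_poincare v : s1 || s2 -> (s1 -> @V1 R v) -> (s2 -> @V2 R v) ->
  (H1_L2norm v <= K%:E * H1_seminorm v)%E.
Proof.
move=> s12 v1 v2.
have [phi [sphi cvphi]] : exists phi, (forall n, is_Ck 1 (phi n)) /\ H1_converges phi v.
  case/orP: s12 => [/v1|/v2] [g [_ [phi [sphi cphi _]]] _].
    by exists phi; split => // n; exact: sphi.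
  by exists phi; split => // n; exact: sphi.
have [c0 cx cy] := cvphi.
pose b1 f := if s1 then 2 * leg_mean1 f else 0 : R.
pose b2 f := if s2 then 2 * leg_mean2 f else 0 : R.
have cleg1 : continuous (@legOA R).
  by apply: continuous_pair => t; [exact: cvg_id|exact: cvg_cst].
have cleg2 : continuous (@legOB R).
  by apply: continuous_pair => t; [exact: cvg_cst|exact: cvg_id].
have cb1 : (fun n => `|b1 (phi n)|%:E) @ \oo --> 0%E.
  rewrite /b1; case: s1 v1 => [/(_ isT) v1|_]; last by rewrite normr0; exact: cvg_cst.
  rewrite (_ : (fun n => _) = (fun n => 2%:E * `|leg_mean1 (phi n)|%:E)%E).
    apply: cvge0Z; apply: (leg_mean_cvg cleg1 _ v1 sphi cvphi) => f fx fy C.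
    by have [] := leg_mean_le C.
  by apply/funext => n; rewrite normrM ger0_norm.
have cb2 : (fun n => `|b2 (phi n)|%:E) @ \oo --> 0%E.
  rewrite /b2; case: s2 v2 => [/(_ isT) v2|_]; last by rewrite normr0; exact: cvg_cst.
  rewrite (_ : (fun n => _) = (fun n => 2%:E * `|leg_mean2 (phi n)|%:E)%E).
    apply: cvge0Z; apply: (leg_mean_cvg cleg2 _ v2 sphi cvphi) => f fx fy C.
    by have [] := leg_mean_le C.
  by apply/funext => n; rewrite normrM ger0_norm.
pose u n := (LT (fun p => (phi n p - v p)%R) +
  (K%:E * (LT (fun p => (dx (phi n) p - H1dx v p)%R) +
           LT (fun p => (dy (phi n) p - H1dy v p)%R)) +
   (K + 1)%:E * (`|b1 (phi n)|%:E + `|b2 (phi n)|%:E)))%E.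
have u0 : u @ \oo --> 0%E.
  by apply: cvge0D => //; apply: cvge0D; apply: cvge0Z; exact: cvge0D.
have : (fun n => K%:E * H1_seminorm v + u n)%E @ \oo --> (K%:E * H1_seminorm v + 0)%E.
  by apply: cvgeD => //; [exact: fin_num_adde_defl|exact: cvg_cst].
rewrite adde0 => /cvge_to_ge; apply; apply: nearW => n.
have C := is_C1_C1plane (sphi n); have [cf cfx cfy _ _] := C.
have mv := (H1fun_L2 v).1; have mvx := (H1dx_L2 v).1; have mvy := (H1dy_L2 v).1.
have [mf mfx mfy] : [/\ mfun (phi n), mfun (dx (phi n)) & mfun (dy (phi n))].
  by split; exact: continuous_mfun.
apply: (@le_trans _ _ (LT (fun p => (phi n p - v p)%R) + LT (phi n))%E).
  rewrite -(LTN (fun p => phi n p - v p)) /H1_L2norm.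
  rewrite {1}(_ : H1fun v = (fun p => - (phi n p - v p) + phi n p)).
    by apply: L2normD => //; apply: measurableT_comp => //; exact: measurable_funB.
  by apply/funext => p; ring.
rewrite [leRHS]addeCA; apply: leeD2l.
apply: (le_trans (C1plane_poincare_defect K0 poincareK C)); rewrite addeA; apply: leeD.
  rewrite -ge0_muleDr ?adde_ge0 ?L2norm_ge0//; apply: lee_wpmul2l.
    by rewrite lee_fin ltW.
  rewrite {1}(_ : dx (phi n) = (fun p => H1dx v p + (dx (phi n) p - H1dx v p))).
    rewrite {1}(_ : dy (phi n) = (fun p => H1dy v p + (dy (phi n) p - H1dy v p))).
      by apply: L2norm_gradD; [exact: mvx|exact: mvy|exact: measurable_funB..].
    by apply/funext => p; rewrite addrC subrK.
  by apply/funext => p; rewrite addrC subrK.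
by rewrite EFinM EFinD.
Qed.

End Limit.

(** * Extremal functions *)

Section SmoothElements.
Context {R : realType}.
Implicit Types (phi phix phiy : R * R -> R) (e : R -> R * R).

Let is_derive_axis phi (d : R * R) (F : R -> R) (x l : R) (z : R * R) :
  (forall h, phi (h *: d + z) = F (h + x)) -> phi z = F x ->
  is_derive x 1 F l -> derivable phi z d /\ 'D_d phi z = l.
Proof.
move=> E E0 [dF <-]; rewrite /derivable /derive.
have EE : (fun h : R => h^-1 *: (phi (h *: d + z) - phi z)) =
    (fun h : R => h^-1 *: (F (h *: 1 + x) - F x)).
  by apply/funext => h; rewrite E E0 /GRing.scale/= mulr1.
by rewrite EE.
Qed.

Lemma C1plane_partial phi phix phiy : C1plane phi phix phiy ->
  [/\ forall p, derivable phi p (1, 0), forall p, derivable phi p (0, 1),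
      dx phi = phix & dy phi = phiy].
Proof.
move=> [_ _ _ dpx dpy].
have hx x y : derivable phi (x, y) (1, 0) /\ dx phi (x, y) = phix (x, y).
  apply: (is_derive_axis _ _ (dpx x y)) => // h; congr phi; congr pair.
    by change (h * 1 + x = h + x); ring.
  by change (h * 0 + y = y); ring.
have hy x y : derivable phi (x, y) (0, 1) /\ dy phi (x, y) = phiy (x, y).
  apply: (is_derive_axis _ _ (dpy x y)) => // h; congr phi; congr pair.
    by change (h * 0 + x = x); ring.
  by change (h * 1 + y = h + y); ring.
by split; [move=> [x y]; case: (hx x y)|move=> [x y]; case: (hy x y)|
  apply/funext => -[x y]; case: (hx x y)|apply/funext => -[x y]; case: (hy x y)].
Qed.

(** Amplitudes and phases are kept general because differentiation multiplies the former and shifts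
    the latter by pi / 2: the family is closed under partial derivatives, and smoothness follows by
    induction. *)
Definition trig_plane (a w s b w' s' : R) : R * R -> R :=
  fun z => a * cos (w * z.1 + s) + b * cos (w' * z.2 + s').

Let is_derive_cos_affine (a w s x : R) :
  is_derive x 1 (fun t => a * cos (w * t + s)) (a * w * cos (w * x + (s + pi / 2))).
Proof.
have dl : is_derive x 1 (fun y : R => w * y + s) w.
  by apply: trigger_derive; rewrite /GRing.scale /=; ring.
have dc := @is_derive1_comp R cos (fun y => w * y + s) x _ _ (is_derive_cos _) dl.
have := @is_deriveZ R _ _ _ a x 1 _ dc.
rewrite (_ : a *: _ = a * w * cos (w * x + (s + pi / 2)))//.
by rewrite addrA cosDpihalf /GRing.scale/=; ring.
Qed.

Lemma C1plane_trig (a w s b w' s' : R) : C1plane (trig_plane a w s b w' s')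
  (trig_plane (a * w) w (s + pi / 2) 0 w' s')
  (trig_plane 0 w s (b * w') w' (s' + pi / 2)).
Proof.
have ct (a' v r b' v' r' : R) : continuous (trig_plane a' v r b' v' r').
  move=> z; apply: cvgD; (apply: cvgM; first exact: cvg_cst).
    apply: (@continuous_comp _ _ _ (fun z : R * R => v * z.1 + r) cos).
      by apply: cvgD; [apply: cvgM; [exact: cvg_cst|exact: continuous_fst]|exact: cvg_cst].
    exact: continuous_cos.
  apply: (@continuous_comp _ _ _ (fun z : R * R => v' * z.2 + r') cos).
    by apply: cvgD; [apply: cvgM; [exact: cvg_cst|exact: continuous_snd]|exact: cvg_cst].
  exact: continuous_cos.
split; [exact: ct|exact: ct|exact: ct|move=> x y|move=> x y].
  rewrite /trig_plane/= mul0r.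
  exact: (is_deriveD (is_derive_cos_affine a w s x) (is_derive_cst _ _ _)).
rewrite /trig_plane/= mul0r.
exact: (is_deriveD (is_derive_cst _ _ _) (is_derive_cos_affine b w' s' y)).
Qed.

Lemma smooth_trig (a w s b w' s' : R) : smooth (trig_plane a w s b w' s').
Proof.
move=> k; elim: k a s b s' => [|k ih] a s b s'.
  by split=> //; have [] := C1plane_trig a w s b w' s'.
have C := C1plane_trig a w s b w' s'; have [d1 d2 ex ey] := C1plane_partial C.
by split; [case: C|split=> //; rewrite ?ex ?ey; exact: ih].
Qed.

Lemma in_L2_continuous phi : continuous phi -> in_L2 (leb2 R) (@triangle R) phi.
Proof.
by move=> c; split; [exact: continuous_mfun|rewrite L2norm_triangle// ltry].
Qed.

Let test_function_out phi z : test_function phi -> ~ triangle z -> phi z = 0.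
Proof.
move=> [_ _ sub] nz; apply: contrapT => /eqP pz; apply: nz; apply: sub.
exact: subset_closure.
Qed.

Let product_derivative phi phix phiy psi : C1plane phi phix phiy ->
  C1plane psi (dx psi) (dy psi) ->
  [/\ continuous (fun z => phi z * dx psi z), continuous (fun z => phix z * psi z),
      continuous (fun z => phi z * dy psi z) & continuous (fun z => phiy z * psi z)].
Proof.
move=> [c cx cy _ _] [d dX dY _ _]; split=> z.
- exact: cvgM (c z) (dX z).
- exact: cvgM (cx z) (d z).
- exact: cvgM (c z) (dY z).
- exact: cvgM (cy z) (d z).
Qed.

Let integral_product (phi f psi g : R * R -> R) : continuous (fun z => phi z * psi z) ->
  continuous (fun z => f z * g z) ->
  \int[leb2 R]_(z in @triangle R) (phi z * psi z + f z * g z) = 0 ->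
  \int[leb2 R]_(z in @triangle R) (phi z * psi z) =
  - \int[leb2 R]_(z in @triangle R) (f z * g z).
Proof.
move=> c1 c2; rewrite RintegralD; [|exact: measurable_triangle|
  exact: integrable_triangle c1|exact: integrable_triangle c2].
by move/eqP; rewrite addr_eq0 => /eqP.
Qed.

(* Integrate [d/dx (phi psi)] along horizontal segments, at whose end points
   the test function vanishes; [C1plane_weak_dy] does so along vertical ones. *)
Lemma C1plane_weak_dx phi phix phiy : C1plane phi phix phiy ->
  weak_derivative (@dx R) phi phix.
Proof.
move=> C psi tpsi; have Cpsi : C1plane psi (dx psi) (dy psi).
  by apply: is_C1_C1plane; case: tpsi => /(_ 1%N).
have [c1 c2 _ _] := product_derivative C Cpsi.
have cg : continuous (fun z => phi z * dx psi z + phix z * psi z).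
  by move=> z; exact: cvgD (c1 z) (c2 z).
apply: integral_product => //; rewrite (triangle_int2 cg).
rewrite -[RHS](int01_cst 0); apply: eq_int01 => x x01.
have CF : C1on (fun p => phi (p, 1 - x) * psi (p, 1 - x))
    (fun p => phi (p, 1 - x) * dx psi (p, 1 - x) + phix (p, 1 - x) * psi (p, 1 - x)).
  split.
    exact: continuous_subspaceT (continuous_line1 (y := 1 - x) cg).
  move=> p _; case: C => _ _ _ d1 _; case: Cpsi => _ _ _ d2 _.
  have := is_deriveM (d1 p (1 - x)) (d2 p (1 - x)).
  by rewrite /GRing.scale/= (mulrC (psi _)).
rewrite (int01_split x01 CF (C1on_cst 0)).
have -> : psi (x, 1 - x) = 0 by apply: (test_function_out tpsi); case=> /=; lra.
have -> : psi (0, 1 - x) = 0 by apply: (test_function_out tpsi); case=> /=; lra.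
by ring.
Qed.

Lemma C1plane_weak_dy phi phix phiy : C1plane phi phix phiy ->
  weak_derivative (@dy R) phi phiy.
Proof.
move=> C psi tpsi; have Cpsi : C1plane psi (dx psi) (dy psi).
  by apply: is_C1_C1plane; case: tpsi => /(_ 1%N).
have [_ _ c1 c2] := product_derivative C Cpsi.
have cg : continuous (fun z => phi z * dy psi z + phiy z * psi z).
  by move=> z; exact: cvgD (c1 z) (c2 z).
apply: integral_product => //; rewrite (triangle_int1 cg).
rewrite -[RHS](int01_cst 0); apply: eq_int01 => x x01.
have CF : C1on (fun q => phi (x, q) * psi (x, q))
    (fun q => phi (x, q) * dy psi (x, q) + phiy (x, q) * psi (x, q)).
  split.
    exact: continuous_subspaceT (continuous_line2 (x := x) cg).
  move=> q _; case: C => _ _ _ _ d1; case: Cpsi => _ _ _ _ d2.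
  have := is_deriveM (d1 x q) (d2 x q).
  by rewrite /GRing.scale/= (mulrC (psi _)).
have := int01_above x01 (C1onZ (-1) (C1on_flip CF)).
have -> : psi (x, -1 * 1 + 1) = 0.
  by apply: (test_function_out tpsi); case=> /=; lra.
have -> : psi (x, -1 * x + 1) = 0.
  by apply: (test_function_out tpsi); case=> /=; lra.
rewrite !mulr0 subrr => E; apply: etrans E; apply: eq_int01 => p _; case: ifP => // _.
by rewrite mulrA mulrNN !mul1r (_ : -1 * p + 1 = 1 - p)//; ring.
Qed.

Definition H1_of_C1plane phi phix phiy (C : C1plane phi phix phiy) : H1 R :=
  let: And5 c cx cy _ _ := C in
  MkH1 (in_L2_continuous c) (in_L2_continuous cx) (in_L2_continuous cy)
    (C1plane_weak_dx C) (C1plane_weak_dy C).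

Lemma H1_of_C1planeE phi phix phiy (C : C1plane phi phix phiy) :
  [/\ H1_of_C1plane C = phi :> (R * R -> R), H1dx (H1_of_C1plane C) = phix &
      H1dy (H1_of_C1plane C) = phiy].
Proof. by case: C. Qed.

Lemma L2norm0 d (X : measurableType d) (mu : {measure set X -> \bar R}) (D : set X) :
  L2norm mu D (fun=> 0 : R) = 0%E.
Proof.
rewrite /L2norm (_ : EFin \o _ = cst 0%E) ?Lnorm0//.
by apply/funext => x; rewrite /= patchE; case: ifP.
Qed.

(** A smooth function is approximated by the constant sequence, and its trace is its restriction. *)
Lemma V_of_C1plane e phi phix phiy (C : C1plane phi phix phiy) : smooth phi ->
  continuous e -> int01 (fun t => phi (e t)) = 0 -> V e (H1_of_C1plane C).
Proof.
move=> sphi ce mean0; have [E0 Ex Ey] := H1_of_C1planeE C.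
have [_ _ dxE dyE] := C1plane_partial C.
have cphi : continuous (fun t => phi (e t)).
  by have [c _ _ _ _] := C => t; exact: (@continuous_comp _ _ _ e phi t (ce t) (c (e t))).
have mphi := continuous_bmeas cphi.
exists (fun t => phi (e t)) => //; split.
  split; first exact: mphi.1.
  rewrite L2norm_fin ?ltry//.
  by apply: bmeas_integrable; exact: bmeasX.
have Z d (X : measurableType d) (mu : {measure set X -> \bar R}) (D : set X)
    (f : X -> R) : (fun _ : nat => L2norm mu D (fun p => f p - f p)) @ \oo --> 0%E.
  rewrite (_ : (fun p => f p - f p) = fun=> 0); first by rewrite L2norm0; exact: cvg_cst.
  by apply/funext => p; rewrite subrr.
exists (fun=> phi); split => //.
by split; rewrite ?E0 ?Ex ?Ey ?dxE ?dyE; exact: Z.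
Qed.

End SmoothElements.

(** * Additive trigonometric functions as extremals *)

Section Extremal.
Context {R : realType}.
Variables (w s : R).
Hypothesis w0 : w != 0.

Let f (x : R) : R := cos (w * x + s).
Let f' (x : R) : R := - w * sin (w * x + s).
Let J := int01 f.

(** This is [f x + f (1 - y)], whose reflected kernel is the additive [f x + f p]. *)
Let u := trig_plane 1 w s 1 (- w) (w + s).
Let ux := trig_plane (1 * w) w (s + pi / 2) 0 (- w) (w + s).
Let uy := trig_plane 0 w s (1 * - w) (- w) (w + s + pi / 2).

Let Cu : C1plane u ux uy. Proof. exact: C1plane_trig. Qed.

Let uE x y : u (x, y) = f x + f (1 - y).
Proof. by rewrite /u /trig_plane /f/= !mul1r; congr (_ + cos _); ring. Qed.

Let uxE x y : ux (x, y) = f' x.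
Proof.
by rewrite /ux /trig_plane /f'/= mul0r addr0 mul1r addrA cosDpihalf mulrN mulNr.
Qed.

Let uyE x y : uy (x, y) = - f' (1 - y).
Proof.
rewrite /uy /trig_plane /f'/= mul0r add0r mul1r addrA cosDpihalf.
by rewrite (_ : - w * y + (w + s) = w * (1 - y) + s); ring.
Qed.

Let cf : continuous f.
Proof.
move=> x; apply: (@continuous_comp _ _ _ (fun x => w * x + s) cos).
  by apply: cvgD; [apply: cvgM; [exact: cvg_cst|exact: cvg_id]|exact: cvg_cst].
exact: continuous_cos.
Qed.

Let cf' : continuous f'.
Proof.
move=> x; apply: cvgM; first exact: cvg_cst.
apply: (@continuous_comp _ _ _ (fun x => w * x + s) sin).
  by apply: cvgD; [apply: cvgM; [exact: cvg_cst|exact: cvg_id]|exact: cvg_cst].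
exact: continuous_sin.
Qed.

Let dl (x : R) : is_derive x 1 (fun y : R => w * y + s) w.
Proof. by apply: trigger_derive; rewrite /GRing.scale /=; ring. Qed.

Let C1f : C1on f f'.
Proof.
split=> [|x _]; first exact: continuous_subspaceT.
have := @is_derive1_comp R cos (fun y => w * y + s) x _ _ (is_derive_cos _) (dl x).
by have -> : - sin (w * x + s) * w = f' x by rewrite /f'; ring.
Qed.

Let C1f' : C1on f' (fun x => - w ^+ 2 * f x).
Proof.
split=> [|x _].
  by apply: continuous_subspaceT => x; apply: cvgM; [exact: cvg_cst|exact: cf].
have ds := @is_derive1_comp R sin (fun y => w * y + s) x _ _ (is_derive_sin _) (dl x).
have := @is_deriveZ R _ _ _ (- w) x 1 _ ds.
by rewrite (_ : - w *: _ = - w ^+ 2 * f x)// /GRing.scale/= /f; ring.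
Qed.

Let mf : bmeas f. Proof. exact: bmeasC1 C1f. Qed.
Let mf' : bmeas f'. Proof. exact: bmeasC1' C1f. Qed.

Lemma extremal_mean : w * J = sin (w + s) - sin s.
Proof.
have := int01_FTC C1f'; rewrite int01Zl// -/J /f' !mulr1 mulr0 add0r => E.
apply: (mulfI w0).
by rewrite mulrA -expr2 -[LHS]opprK -mulNr E; ring.
Qed.

Let N := \int[leb2 R]_(z in @triangle R) (u z ^+ 2).
Let G := \int[leb2 R]_(z in @triangle R) (ux z ^+ 2 + uy z ^+ 2).

Let NE : N = int01 (fun x => f x ^+ 2) + J ^+ 2.
Proof.
have [cu _ _ _ _] := Cu.
have mG : bmeas2 (fun x p => (f x + f p) ^+ 2).
  by apply: bmeas2X; apply: bmeas2D; [exact: bmeas2_fst|exact: bmeas2_snd].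
have := triangle_split (continuous_sqr cu) (continuous_sqr cu) mG.
rewrite -/N => /(_ _)/esym E.
apply: (mulfI (_ : 2 != 0 :> R)) => //; rewrite mulr_natl mulr2n E; last first.
  move=> x p _; rewrite !uE !subKr; case: ifP => // _; congr (_ ^+ 2).
  exact: addrC.
transitivity (int01 (fun x => (int01 (fun p => f p ^+ 2) + 2 * J * f x) + f x ^+ 2)).
  apply: eq_int01 => x _.
  transitivity (int01 (fun p => f p ^+ 2 + 2 * f x * f p + f x ^+ 2)).
    by apply: eq_int01 => p _; ring.
  by rewrite int01D ?int01D ?int01Zl ?int01_cst -/J; [ring|bmeas_tac..].
by rewrite int01D ?int01D ?int01Zl ?int01_cst -/J; [ring|bmeas_tac..].
Qed.

Let GE : G = int01 (fun x => f' x ^+ 2).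
Proof.
have [_ cx cy _ _] := Cu.
have mG : bmeas2 (fun x _ => f' x ^+ 2) by apply: bmeas2_fst; exact: bmeasX.
have := triangle_split (continuous_sqr cx) (continuous_sqr cy) mG.
rewrite -RintegralD; [|exact: measurable_triangle|
  exact: integrable_triangle (continuous_sqr cx)|exact: integrable_triangle (continuous_sqr cy)].
rewrite -/G => <-; first by apply: eq_int01 => x _; rewrite int01_cst.
by move=> x p _; rewrite uxE uyE subKr sqrrN; case: ifP.
Qed.

(** The means of [u] over OB and OA are [f 0 + J] and [f 1 + J]. At each end either this mean
    vanishes or, if the leg is free, the natural condition [f' = 0] holds; the product covers
    both. *)
Hypothesis bc0 : f' 0 * (f 0 + J) = 0.
Hypothesis bc1 : f' 1 * (f 1 + J) = 0.

(** Integrating by parts with [f'' = - w^2 f], and using w^2 J = f' 0 - f' 1, shows that G - w^2 N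
    is the increment of [f' * (f + J)] from 0 to 1, which the boundary conditions annul. *)
Let GN : G = w ^+ 2 * N.
Proof.
have E1 := int01_FTC C1f'; rewrite int01Zl// -/J in E1.
have E2 := int01_FTC (C1onM C1f C1f').
have {}E2 : int01 (fun x => f' x ^+ 2) - w ^+ 2 * int01 (fun x => f x ^+ 2) =
    f 1 * f' 1 - f 0 * f' 0.
  rewrite -E2 -int01Zl; last exact: bmeasX.
  rewrite -int01B; [|bmeas_tac..].
  by apply: eq_int01 => x _; ring.
rewrite GE NE mulrDr.
have : w ^+ 2 * J * J = - (f' 1 - f' 0) * J by rewrite -E1; ring.
have := bc0; have := bc1; rewrite !mulrDr; lra.
Qed.

Hypothesis J0 : J != 0.

Definition extremal : H1 R := H1_of_C1plane Cu.

Let N_gt0 : 0 < N.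
Proof.
rewrite NE ltr_wpDl//; last by rewrite exprn_even_gt0.
by apply: int01_ge0 => x _; exact: sqr_ge0.
Qed.

Lemma extremal_ratio (k : R) : 0 < k -> k ^+ 2 = w ^+ 2 ->
  (H1_L2norm extremal / H1_seminorm extremal)%E = (1 / k)%:E.
Proof.
move=> k0 kw; have [E0 Ex Ey] := H1_of_C1planeE Cu.
have [cu cx cy _ _] := Cu.
rewrite /H1_L2norm /H1_seminorm /extremal E0 Ex Ey.
rewrite [X in (X / _)%E](L2norm_triangle cu) [X in (_ / X)%E](L2norm_grad_triangle cx cy).
rewrite -/N -/G GN -kw sqrtrM ?sqr_ge0// sqrtr_sqr gtr0_norm//.
have sN : 0 < Num.sqrt N by rewrite sqrtr_gt0.
rewrite inver gt_eqF ?mulr_gt0// -EFinM; congr EFin.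
by field; rewrite !gt_eqF.
Qed.

Lemma extremal_neq0 : ~ @H1_zero R extremal.
Proof.
have [E0 _ _] := H1_of_C1planeE Cu; have [cu _ _ _ _] := Cu.
rewrite /H1_zero/= /extremal E0 => u0.
have := N_gt0; rewrite (_ : N = 0) ?ltxx//.
rewrite /N /Rintegral (_ : integral _ _ _ = 0%E)//.
rewrite -(integral0 (leb2 R) (@triangle R)); apply: ae_eq_integral => //.
- exact: measurable_triangle.
- apply/measurable_EFinP; apply: measurable_funX; exact: continuous_mfun.
case: u0 => B [mB B0 uB]; exists B; split => // p np; apply: uB => up; apply: np => Tp.
by rewrite /= up// expr0n.
Qed.

Lemma extremal_V1 : f 1 + J = 0 -> @V1 R extremal.
Proof.
move=> h; apply: V_of_C1plane; first exact: smooth_trig.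
  by apply: continuous_pair => t; [exact: cvg_id|exact: cvg_cst].
transitivity (int01 (fun t => f t + f 1)).
  by apply: eq_int01 => t _; rewrite uE subr0.
by rewrite int01D ?int01_cst -/J; [rewrite addrC|bmeas_tac..].
Qed.

Lemma extremal_V2 : f 0 + J = 0 -> @V2 R extremal.
Proof.
move=> h; apply: V_of_C1plane; first exact: smooth_trig.
  by apply: continuous_pair => t; [exact: cvg_cst|exact: cvg_id].
have cr : bmeas (fun t => f (1 - t)).
  apply: continuous_bmeas => t; apply: (@continuous_comp _ _ _ (fun t : R => 1 - t) f).
    by apply: cvgB; [exact: cvg_cst|exact: cvg_id].
  exact: cf.
transitivity (int01 (fun t => f 0 + f (1 - t))).
  by apply: eq_int01 => t _; rewrite uE.
rewrite int01D ?int01_cst; [|bmeas_tac..].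
by rewrite int01_reflect//; exact: continuous_subspaceT.
Qed.

End Extremal.

(** * Evaluation of a supremum of ratios *)

Section Supremum.
Context {R : realType}.

Lemma L2norm_eq0 (v : H1 R) : H1_L2norm v = 0%E -> @H1_zero R v.
Proof.
move=> /Lnorm_eq0_eq0 h.
have mv : measurable_fun setT (EFin \o (H1fun v \_ (@triangle R))).
  by apply/measurable_EFinP/(measurable_restrictT _ measurable_triangle); exact: (H1fun_L2 v).1.
have [|B [mB B0 vB]] := h mv; first by rewrite lte_fin.
exists B; split => // p np; apply: vB => vp; apply: np => Tp.
by move: vp; rewrite /= patchE mem_set// => /(_ I)[].
Qed.

Lemma sup_ratio_eq (W : set (H1 R)) (K : R) (w : H1 R) : 0 < K ->
  (forall v, W v -> (H1_L2norm v <= K%:E * H1_seminorm v)%E) ->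
  W w -> ~ @H1_zero R w -> (H1_L2norm w / H1_seminorm w)%E = K%:E ->
  sup_ratio W = K%:E.
Proof.
move=> K0 ub Ww wn0 rw; apply/eqP; rewrite eq_le; apply/andP; split; last first.
  by apply: ereal_sup_ubound; exists w.
apply: ge_ereal_sup => _ [v [Wv vn0] <-].
have Lv0 : H1_L2norm v != 0%E by apply/eqP => /L2norm_eq0.
have Lv : (0 <= H1_L2norm v)%E by exact: L2norm_ge0.
have n0 : (0 <= H1_seminorm v)%E by exact: L2norm_ge0.
have := ub v Wv; case: (H1_seminorm v) n0 => [r||] // n0 h.
(* A zero semi-norm would force a zero norm by the bound, so division by zero never enters the
   supremum. *)
- have [r0|r0] := eqVneq r 0.
    by move: h Lv0; rewrite r0 mule0 => h; rewrite eq_le h Lv.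
  have rp : 0 < r by rewrite lt_neqAle eq_sym r0 -lee_fin.
  rewrite inver (negbTE r0); apply: (@le_trans _ _ (K%:E * r%:E * r^-1%:E)%E).
    by apply: lee_wpmul2r => //; rewrite lee_fin invr_ge0 ltW.
  by rewrite -!EFinM lee_fin mulfK.
- by rewrite invey mule0 lee_fin ltW.
Qed.

End Supremum.

(** * The constants *)

Section Constants.
Context {R : realType}.
Variable k : R.
Hypotheses (k_bounds : 2 < k < 21 / 10) (k_root : k * cos k + sin k = 0).

Let k0 : 0 < k. Proof. by move/andP : k_bounds => [? _]; lra. Qed.

Let sink : 0 < sin k.
Proof. by move/andP : k_bounds => [? ?]; apply: sin_gt0_lt; lra. Qed.

Let rescale (m x y : R) : 0 < m -> m ^+ 2 * x <= y -> x <= (1 / m) ^+ 2 * y.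
Proof.
by move=> m0 h; rewrite div1r exprVn mulrC ler_pdivlMr ?exprn_gt0// mulrC.
Qed.

(** With frequency k and phase 0, [f'] vanishes at 0, the free end, and J = sin k / k = - cos k = -
    f 1 by the equation for k. *)
Lemma C1_value : C1 R = (1 / k)%:E.
Proof.
have kn0 : k != 0 by rewrite gt_eqF.
have := extremal_mean 0 kn0; set J := int01 _; rewrite addr0 sin0 subr0 => EJ.
have JE : J = - cos k by apply: (mulfI kn0); have := k_root; lra.
have J0 : J != 0.
  by apply/eqP => j0; move: EJ sink; rewrite j0 mulr0 => <-; rewrite ltxx.
have bc0 : - k * sin (k * 0 + 0) * (cos (k * 0 + 0) + J) = 0.
  by rewrite mulr0 addr0 sin0 mulr0 mul0r.
have f1 : cos (k * 1 + 0) + J = 0 by rewrite mulr1 addr0 JE subrr.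
have bc1 : - k * sin (k * 1 + 0) * (cos (k * 1 + 0) + J) = 0 by rewrite f1 mulr0.
apply: (sup_ratio_eq (w := extremal k 0)).
- by rewrite divr_gt0.
- move=> v v1; apply: (@H1_poincare R true false) => //; first by rewrite divr_gt0.
  move=> phi phix phiy C m1 _; apply: rescale => //.
  exact: C1plane_poincare1 C _ k_bounds k_root (m1 isT).
- exact: extremal_V1.
- exact: extremal_neq0.
- exact: extremal_ratio.
Qed.

(** The phase - k makes [f x] equal to cos (k (x - 1)): now the free end is 1, and J = - cos k = - f
    0. *)
Lemma C2_value : C2 R = (1 / k)%:E.
Proof.
have kn0 : k != 0 by rewrite gt_eqF.
have := extremal_mean (- k) kn0; set J := int01 _; rewrite subrr sin0 sinN sub0r opprK => EJ.
have JE : J = - cos k by apply: (mulfI kn0); have := k_root; lra.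
have J0 : J != 0.
  by apply/eqP => j0; move: EJ sink; rewrite j0 mulr0 => <-; rewrite ltxx.
have f0 : cos (k * 0 - k) + J = 0 by rewrite mulr0 add0r cosN JE subrr.
have bc0 : - k * sin (k * 0 - k) * (cos (k * 0 - k) + J) = 0 by rewrite f0 mulr0.
have bc1 : - k * sin (k * 1 - k) * (cos (k * 1 - k) + J) = 0.
  by rewrite mulr1 subrr sin0 mulr0 mul0r.
apply: (sup_ratio_eq (w := extremal k (- k))).
- by rewrite divr_gt0.
- move=> v v2; apply: (@H1_poincare R false true) => //; first by rewrite divr_gt0.
  move=> phi phix phiy C _ m2; apply: rescale => //.
  exact: C1plane_poincare2 C _ k_bounds k_root (m2 isT).
- exact: extremal_V2.
- exact: extremal_neq0.
- exact: extremal_ratio.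
Qed.

(** Frequency 2 k and phase - k give [f x] = cos (k (2 x - 1)), symmetric about 1 / 2, with J = -
    cos k, so that both leg means vanish. *)
Lemma C12_value : C12 R = (1 / (2 * k))%:E.
Proof.
have kk0 : 0 < 2 * k by rewrite mulr_gt0.
have kn0 : 2 * k != 0 by rewrite gt_eqF.
have := extremal_mean (- k) kn0; set J := int01 _.
rewrite (_ : 2 * k - k = k) ?sinN ?opprK => [EJ|]; last by ring.
have JE : J = - cos k by apply: (mulfI kn0); have := k_root; lra.
have J0 : J != 0.
  by apply/eqP => j0; move: EJ sink; rewrite j0 mulr0; lra.
have f0 : cos (2 * k * 0 - k) + J = 0 by rewrite mulr0 add0r cosN JE subrr.
have f1 : cos (2 * k * 1 - k) + J = 0.
  by rewrite (_ : 2 * k * 1 - k = k) ?JE ?subrr//; ring.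
have bc0 : - (2 * k) * sin (2 * k * 0 - k) * (cos (2 * k * 0 - k) + J) = 0.
  by rewrite f0 mulr0.
have bc1 : - (2 * k) * sin (2 * k * 1 - k) * (cos (2 * k * 1 - k) + J) = 0.
  by rewrite f1 mulr0.
apply: (sup_ratio_eq (w := extremal (2 * k) (- k))).
- by rewrite divr_gt0.
- move=> v [v1 v2]; apply: (@H1_poincare R true true) => //; first by rewrite divr_gt0.
  move=> phi phix phiy C m1 m2; apply: rescale => //.
  rewrite (_ : (2 * k) ^+ 2 = 4 * k ^+ 2); last by ring.
  exact: C1plane_poincare12 C _ k_bounds k_root (m1 isT) (m2 isT).
- by split; [exact: extremal_V1|exact: extremal_V2].
- exact: extremal_neq0.
- exact: extremal_ratio.
Qed.

End Constants.

Theorem theorem2p1 (R : realType) :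
  (exists mu : R,
     [/\ positive_solution mu,
         forall nu : R, positive_solution nu -> nu <= mu &
         C12 R = mu%:E]) /\
  (C12 R = (1 / 2)%:E * C1 R)%E /\
  (C12 R = (1 / 2)%:E * C2 R)%E /\
  ((24641%:R / 10 ^+ 5)%:E < C12 R)%E /\
  (C12 R < (24647%:R / 10 ^+ 5)%:E)%E.
Proof.
have [k [/andP[klo khi] kroot kmin]] := @transcendental_root R.
have kb : 2 < k < 21 / 10 by apply/andP; split; lra.
have k0 : 0 < k by lra.
have kn0 : k != 0 by rewrite gt_eqF.
have sink : 0 < sin k by apply: sin_gt0_lt; lra.
rewrite (C12_value kb kroot) (C1_value kb kroot) (C2_value kb kroot).
have half : 1 / (2 * k) = 1 / 2 * (1 / k) by field.
have inv2 (x : R) : x != 0 -> 1 / (2 * (1 / (2 * x))) = x by move=> x0; field.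
split; [|split; [|split; [|split]]].
- exists (1 / (2 * k)); split=> //.
    split; first by rewrite divr_gt0// mulr_gt0.
    rewrite inv2//.
    (* If cos k were zero, the equation for k would give sin k = 0. *)
    have cosk : cos k != 0.
      by apply: contraTneq sink => c0; move: kroot; rewrite c0 mulr0 add0r => ->; rewrite ltxx.
    by apply: (mulIf cosk); rewrite mul0r mulrDl /tan mulfVK.
  move=> nu [nu0]; set x := 1 / (2 * nu) => xE.
  have x0 : 0 < x by rewrite divr_gt0// mulr_gt0.
  have nuE : nu = 1 / (2 * x) by rewrite /x; field; rewrite gt_eqF.
  (* The map x |-> 1 / (2 x) reverses order, so the least root gives the greatest mu. *)
  have kx : k <= x.
    rewrite leNgt; apply/negP => xk; have := kmin x x0 xk.
    have [c0|c0] := eqVneq (cos x) 0.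
      (* At a zero of cos the default value tan x = 0 reduces the equation to x = 0, against x >
         0. *)
      by move: xE x0; rewrite /tan c0 invr0 mulr0 addr0 => ->; rewrite ltxx.
    rewrite (_ : x * cos x + sin x = (x + tan x) * cos x).
      by rewrite xE mul0r ltxx.
    by rewrite mulrDl /tan mulfVK.
  by rewrite nuE !div1r lef_pV2 ?posrE; [lra|exact: mulr_gt0..].
- by rewrite -EFinM half.
- by rewrite -EFinM half.
(* Both numerical bounds follow from 637 / 314 < k < 140 / 69. *)
- by rewrite lte_fin ltr_pdivlMr ?mulr_gt0//; lra.
- by rewrite lte_fin ltr_pdivrMr ?mulr_gt0//; lra.
Qed.
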